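(* Let $d\ge 1$, let $\Sigma_1,\dots,\Sigma_d$ be real symmetric positive-definite $d\times d$ matrices, and let $$\mathcal{E}_i=\{\mathbf{x}\in\mathbb{R}^d : \mathbf{x}^\top\Sigma_i^{-1}\mathbf{x}\le 1\},\qquad i=1,\dots,d.$$ Then the mixed volume of these ellipsoids is $$V_d(\mathcal{E}_1,\dots,\mathcal{E}_d)=\frac{(2\pi)^{d(1-d)/2}}{d!}\prod_{i=1}^d(\det\Sigma_i)^{-1/2}\int_{\mathbb{R}^{d^2}}|\det(x_{ij})|\prod_{i=1}^d\exp\left(-\tfrac12\,\mathbf{x}_i^\top\Sigma_i^{-1}\mathbf{x}_i\right)dx_{11}\cdots dx_{dd},$$ where $\mathbf{x}_i=(x_{i1},\dots,x_{id})^\top$ and $(x_{ij})$ is the $d\times d$ matrix with entries $x_{ij}$, $1\le i,j\le d$.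
   Context: Mixed volume: for convex bodies $K_1,\dots,K_d\subset\mathbb{R}^d$, the function $(\lambda_1,\dots,\lambda_d)\mapsto \mathrm{Vol}_d(\lambda_1K_1+\dots+\lambda_dK_d)$ (Minkowski sums, $\lambda_i\ge 0$) is a homogeneous polynomial of degree $d$, written $$\mathrm{Vol}_d(\lambda_1K_1+\dots+\lambda_dK_d)=\sum_{i_1=1}^d\cdots\sum_{i_d=1}^d\lambda_{i_1}\cdots\lambda_{i_d}V_d(K_{i_1},\dots,K_{i_d})$$ with coefficients symmetric under permutations of $K_{i_1},\dots,K_{i_d}$. The number $V_d(K_1,\dots,K_d)$ is the mixed volume; equivalently, $V_d(K_1,\dots,K_d)=\frac{1}{d!}\frac{\partial^d}{\partial\lambda_1\cdots\partial\lambda_d}$ of this polynomial at $\lambda_1=\dots=\lambda_d=0$. In particular $V_d(K,\dots,K)=\mathrm{Vol}_d(K)$. *)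

(* Defs.v *)
From HB Require Import structures.
From mathcomp Require Import all_boot all_order all_algebra all_fingroup.
From mathcomp Require Import all_classical all_reals all_analysis.

Set Implicit Arguments.
Unset Strict Implicit.
Unset Printing Implicit Defensive.

Import Order.TTheory GRing.Theory Num.Theory.
Import numFieldNormedType.Exports.

Local Open Scope classical_set_scope.
Local Open Scope ring_scope.

Definition tcons (T : Type) (n : nat) (x : T * n.-tuple T) : n.+1.-tuple T :=
  [tuple of x.1 :: x.2].

Lemma measurable_tcons d (T : measurableType d) n :
  measurable_fun [set: T * n.-tuple T] (@tcons T n).
Proof. by apply: measurable_cons; [exact: measurable_fst|exact: measurable_snd]. Qed.

(* A direct proof of sigma-finiteness is needed below: the instance search on
   m1 \x m2 only reaches the product of (sub)probabilities. *)
Section tuple_cons_measure.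
Local Open Scope ereal_scope.
Context d (T : measurableType d) (R : realType) (n : nat).
Variables (m1 : {sigma_finite_measure set T -> \bar R})
          (m2 : {sigma_finite_measure set (n.-tuple T) -> \bar R}).

Definition tcons_measure : set (n.+1.-tuple T) -> \bar R :=
  pushforward (m1 \x m2) (@tcons T n).

Let mtcons0 : tcons_measure set0 = 0.
Proof. by rewrite /tcons_measure /pushforward preimage_set0 measure0. Qed.

Let mtcons_ge0 A : 0 <= tcons_measure A.
Proof. exact: (measure_ge0 (m1 \x m2)). Qed.

Let mtcons_sigma_additive : semi_sigma_additive tcons_measure.
Proof.
move=> F mF tF mUF; rewrite /tcons_measure /pushforward preimage_bigcup.
have mpre A : measurable A -> measurable (@tcons T n @^-1` A).
  by move=> mA; rewrite -[X in measurable X]setTI; exact: measurable_tcons.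
apply: (@measure_semi_sigma_additive _ _ _ (m1 \x m2)).
- by move=> k; exact: mpre.
- apply/trivIsetP => /= i j _ _ ij; rewrite -preimage_setI.
  by move/trivIsetP : tF => /(_ _ _ _ _ ij) ->//; rewrite preimage_set0.
- by rewrite -preimage_bigcup; exact: mpre.
Qed.

HB.instance Definition _ := isMeasure.Build _ _ _ tcons_measure
  mtcons0 mtcons_ge0 mtcons_sigma_additive.

Let mtcons_sigma_finite : sigma_finite setT tcons_measure.
Proof.
have /sigma_finiteP[F [TF ndF Foo]] := sigma_finiteT m1.
have /sigma_finiteP[G [TG ndG Goo]] := sigma_finiteT m2.
pose g (t : n.+1.-tuple T) := (thead t, [tuple of behead t]).
have Kg : cancel (@tcons T n) g.
  by move=> [x t]; rewrite /g /tcons /= theadE; congr pair; exact: val_inj.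
have mg : measurable_fun [set: n.+1.-tuple T] g.
  apply/measurable_fun_pairP; split; first exact: measurable_tnth.
  exact: measurable_behead.
exists (fun k => g @^-1` (F k `*` G k)).
  apply/esym/seteqP; split=> // t _.
  have [i _ Fi] : (\bigcup_i F i) (thead t) by rewrite -TF.
  have [j _ Gj] : (\bigcup_j G j) [tuple of behead t] by rewrite -TG.
  exists (maxn i j) => //; split => /=.
  - by move: Fi; exact/subsetPset/ndF/leq_maxl.
  - by move: Gj; exact/subsetPset/ndG/leq_maxr.
move=> k; have [mF Fk] := Foo k; have [mG Gk] := Goo k; split.
  by rewrite -[X in measurable X]setTI; apply: mg => //; exact: measurableX.
rewrite /= /tcons_measure /pushforward -comp_preimage.
rewrite (_ : g \o @tcons T n = id); last by apply/funext => x /=; rewrite Kg.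
by rewrite preimage_id product_measure1E// lte_mul_pinfty// ge0_fin_numE.
Qed.

HB.instance Definition _ := Measure_isSigmaFinite.Build _ _ _ tcons_measure
  mtcons_sigma_finite.

End tuple_cons_measure.

(* The n-fold product of mu, on the product sigma-algebra of n.-tuple T; see
   tuple_measure_box. *)
Fixpoint tuple_measure d (T : measurableType d) (R : realType)
    (mu : {sigma_finite_measure set T -> \bar R}) (n : nat) :
    {sigma_finite_measure set (n.-tuple T) -> \bar R} :=
  match n with
  | 0 => @dirac _ (0.-tuple T) [tuple] R
  | n'.+1 => tcons_measure mu (tuple_measure mu n')
  end.

Lemma tuple_measure_box d (T : measurableType d) (R : realType)
    (mu : {sigma_finite_measure set T -> \bar R}) (n : nat)
    (A : 'I_n -> set T) : (forall i, measurable (A i)) ->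
  tuple_measure mu n [set t | forall i, A i (tnth t i)] =
  (\prod_(i < n) mu (A i))%E.
Proof.
elim: n A => [|n IHn] A mA.
  rewrite big_ord0 /= diracE mem_set//= => -[]//.
rewrite big_ord_recl -IHn//.
rewrite /= /tcons_measure /pushforward -product_measure1E//; last first.
  have -> : [set t : n.-tuple T | forall i, A (lift ord0 i) (tnth t i)] =
      \big[setI/setT]_(i < n) ((fun t => tnth t i) @^-1` A (lift ord0 i)).
    apply/seteqP; split=> [t At|t].
      by elim/big_ind : _ => //= B C Bt Ct; split.
    by move=> + i /=; rewrite (bigD1 i)//= => -[].
  apply: bigsetI_measurable => i _; rewrite -[X in measurable X]setTI.
  exact: measurable_tnth.
congr (product_measure1 _ _ _); apply/seteqP; split=> [[x t] At|[x t] [Ax At] i].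
  split=> [|i] /=; first by have := At ord0; rewrite tnth0.
  by have := At (lift ord0 i); rewrite tnthS.
by case: (unliftP ord0 i) => [j|] ->; rewrite ?tnthS ?tnth0//; exact: At.
Qed.

Definition lebesgue_tuple (R : realType) (n : nat) :
    {sigma_finite_measure set (n.-tuple (measurableTypeR R)) -> \bar R} :=
  tuple_measure (@lebesgue_measure R) n.

Definition cV_of_tuple (R : realType) (d : nat) (t : d.-tuple R) : 'cV[R]_d :=
  \col_i tnth t i.

(* R^(m * n) seen as the m x n matrices, in row-major order. *)
Definition mx_of_tuple (R : realType) (m n : nat) (t : (m * n).-tuple R) :
    'M[R]_(m, n) :=
  \matrix_(i, j) tnth t (mxvec_index i j).

Definition volume (R : realType) (d : nat) (A : set 'cV[R]_d) : \bar R :=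
  lebesgue_tuple R d (@cV_of_tuple R d @^-1` A).

Definition minkowski_comb (R : realType) (d n : nat)
    (K : 'I_n -> set 'cV[R]_d) (lam : 'I_n -> R) : set 'cV[R]_d :=
  [set x | exists y : 'I_n -> 'cV[R]_d,
    (forall i, K i (y i)) /\ x = \sum_i lam i *: y i].

(* c [ffun k => i_k] stands for V_d(K_(i_1), ..., K_(i_d)). *)
Definition mixed_volume_coefs (R : realType) (d : nat)
    (K : 'I_d -> set 'cV[R]_d) (c : {ffun 'I_d -> 'I_d} -> R) : Prop :=
  (forall (s : {perm 'I_d}) (f : {ffun 'I_d -> 'I_d}),
     c [ffun k => f (s k)] = c f) /\
  (forall lam : 'I_d -> R, (forall i, 0 <= lam i) ->
     volume (minkowski_comb K lam) =
     (\sum_(f : {ffun 'I_d -> 'I_d}) (\prod_(k < d) lam (f k)) * c f)%:E).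

(* The symmetric coefficients c are unique when they exist, which they do for
   convex bodies; the value 0 is only a default for other families of sets. *)
Definition mixed_volume (R : realType) (d : nat)
    (K : 'I_d -> set 'cV[R]_d) : R :=
  xget 0 [set v | exists c, mixed_volume_coefs K c /\ v = c [ffun k => k]].

Definition quad_form (R : realType) (d : nat) (A : 'M[R]_d) (x : 'cV[R]_d) : R :=
  (x^T *m A *m x) 0 0.

Definition posdefmx (R : realType) (d : nat) (A : 'M[R]_d) : Prop :=
  A^T = A /\ forall x : 'cV[R]_d, x != 0 -> 0 < quad_form A x.

Definition ellipsoid (R : realType) (d : nat) (S : 'M[R]_d) : set 'cV[R]_d :=
  [set x | quad_form (invmx S) x <= 1].

(* Main.v *)
Require Import Defs.
From mathcomp Require Import all_boot all_order all_algebra all_fingroup.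
From mathcomp Require Import all_classical all_reals all_analysis.
From mathcomp Require Import measurable_realfun ring lra.

(* Proof idea.  Write Sigma_i = L_i L_i^T with L_i lower triangular, so that the
   i-th ellipsoid is L_i B for the Euclidean unit ball B.  If W is a standard
   Gaussian vector, E|<u, W>| = sqrt(2 / pi) |u|, that is, B is the zonoid
   sqrt(pi / 2) E[-W, W].  Replacing each coordinate of W by a simple function of
   it turns this zonoid into a zonotope Z, with B squeezed between (1 + e)^-1 Z
   and Z + e [-1, 1]^d.  For zonotopes the volume is a sum of determinants,
     vol (sum_j [-v_j, v_j]) = 2^d / d! sum_h |det (v_(h 1), ..., v_(h d))|,
   so vol (sum_i lam_i L_i Z) is a polynomial in lam with coefficients
   proportional to E|det (L_(f k) W_k)_k| for the discretized W.  Dominated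
   convergence gives vol (sum_i lam_i L_i B); polarization isolates the mixed
   volume, and the substitution x_k = L_k w_k yields the integral of the
   statement. *)

Set Implicit Arguments.
Unset Strict Implicit.
Unset Printing Implicit Defensive.

Import Order.TTheory GRing.Theory Num.Theory.
Import numFieldNormedType.Exports.

Local Open Scope classical_set_scope.
Local Open Scope ring_scope.

(** * Lebesgue integration over column vectors *)

Section integral_column_vectors.
Context {R : realType}.
Local Notation mu := (@lebesgue_measure R).

(** The determinant formula concerns finite sums of segments. Passing from them to the ball would
    ask for continuity of volume as a function of the body; two inclusions with bounds explicit in
    the error [e] replace it. They differ in shape because the support function h of Z is only known
    to satisfy (1 - e)|u| <= h(u) <= (1 + e)|u|. The upper bound turns into a dilation. The lower
    bound is void for e >= 1, while adding the cube [-e, e]^d, whose support function is at least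
    e|u|, works for every e >= 0. The cube costs extra generators, and their share in the sum of
    determinants is at most a difference of d-th powers that vanishes with e. The constant of the
    statement: with an unnormalized Gaussian weight, c = 1 / (2 (2 pi)^((d-1)/2)) turns the zonoid
    into the unit ball, and 2^d c^d / d! = (2 pi)^(d(1-d)/2) / d!. The factors L_i are taken
    triangular so that the Jacobian of the substitution on R^(d^2) is read off a diagonal. *)

Definition tuple_of_cV n (x : 'cV[R]_n) : n.-tuple R := [tuple x i 0 | i < n].

Lemma tuple_of_cVK n : cancel (@tuple_of_cV n) (@cV_of_tuple R n).
Proof. by move=> x; apply/colP => i; rewrite mxE tnth_mktuple. Qed.

(** Measurability is taken for the product sigma-algebra on tuples, the one that carries [volume];
    [open_cV_measurable] relates it to the topology of column vectors. *)
Definition cV_measurable_fun d (T : measurableType d) n (f : 'cV[R]_n -> T) :=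
  measurable_fun [set: n.-tuple (measurableTypeR R)] (f \o @cV_of_tuple R n).

Definition cV_measurable n (A : set 'cV[R]_n) :=
  measurable (@cV_of_tuple R n @^-1` A : set (n.-tuple (measurableTypeR R))).

Definition cV_integral n (f : 'cV[R]_n -> \bar R) : \bar R :=
  (\int[lebesgue_tuple R n]_t f (cV_of_tuple t))%E.

Lemma cV_measurable_fun_coord n (i : 'I_n) :
  @cV_measurable_fun _ (measurableTypeR R) n (fun x : 'cV[R]_n => x i 0).
Proof.
rewrite /cV_measurable_fun [X in measurable_fun _ X](_ : _ = (@tnth _ _ ^~ i)).
  exact: measurable_tnth.
by apply/funext => t /=; rewrite mxE.
Qed.

Lemma cV_measurable_fun_comp d (T : measurableType d) m n
    (f : 'cV[R]_n -> T) (h : 'cV[R]_m -> 'cV[R]_n) :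
  cV_measurable_fun f ->
  (forall i, @cV_measurable_fun _ (measurableTypeR R) _ (fun x => h x i 0)) ->
  cV_measurable_fun (f \o h).
Proof.
move=> mf mh; rewrite /cV_measurable_fun.
rewrite [X in measurable_fun _ X](_ : _ = (f \o @cV_of_tuple R n) \o
    (@tuple_of_cV n \o h \o @cV_of_tuple R m)); last first.
  by apply/funext => t /=; rewrite tuple_of_cVK.
apply: measurableT_comp mf _.
apply/(@measurable_fun_tnthP _ _ _ (measurableTypeR R)) => i.
rewrite [X in measurable_fun _ X](_ : _ = (fun x => h x i 0) \o @cV_of_tuple R m).
  exact: mh.
by apply/funext => t /=; rewrite tnth_mktuple.
Qed.

Lemma cV_measurable_fun_mulmx d (T : measurableType d) m n
    (f : 'cV[R]_n -> T) (M : 'M[R]_(n, m)) :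
  cV_measurable_fun f -> cV_measurable_fun (fun x => f (M *m x)).
Proof.
move=> mf; apply: (@cV_measurable_fun_comp _ _ _ _ f (fun x => M *m x)) => // i.
rewrite /cV_measurable_fun [X in measurable_fun _ X](_ : _ = fun t =>
   \sum_(j < m) M i j * tnth t j); last first.
  by apply/funext => t /=; rewrite mxE; apply: eq_bigr => j _; rewrite mxE.
apply: measurable_sum => j; apply: measurable_funM => //.
exact: (@measurable_tnth _ (measurableTypeR R)).
Qed.

Definition cV_cons n (x : R) (y : 'cV[R]_n) : 'cV[R]_n.+1 :=
  col_mx (x%:M : 'cV_1) y.

Lemma cV_cons0 n x (y : 'cV[R]_n) : cV_cons x y 0 0 = x.
Proof.
transitivity (col_mx (x%:M : 'cV_1) y (lshift n 0) 0).
  by rewrite /cV_cons; congr (fun_of_matrix _ _ _); exact: val_inj.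
by rewrite col_mxEu mxE eqxx mulr1n.
Qed.

Lemma cV_consS n x (y : 'cV[R]_n) i : cV_cons x y (lift ord0 i) 0 = y i 0.
Proof.
transitivity (col_mx (x%:M : 'cV_1) y (rshift 1 i) 0); last by rewrite col_mxEd.
by rewrite /cV_cons; congr (fun_of_matrix _ _ _); exact: val_inj.
Qed.

Lemma cV_of_tuple_tcons n (p : R * n.-tuple R) :
  cV_of_tuple (tcons p) = cV_cons p.1 (cV_of_tuple p.2).
Proof.
apply/colP => i; rewrite mxE; case: (unliftP ord0 i) => [j|] ->.
  by rewrite cV_consS tnthS mxE.
by rewrite cV_cons0 tnth0.
Qed.

Lemma cV_cons_eta n (x : 'cV[R]_n.+1) :
  x = cV_cons (x 0 0) (\col_i x (lift ord0 i) 0).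
Proof.
apply/colP => i; case: (unliftP ord0 i) => [j|] ->; last by rewrite cV_cons0.
by rewrite cV_consS mxE.
Qed.

Lemma measurable_cV_cons d (T : measurableType d) n (f : 'cV[R]_n.+1 -> T) :
  cV_measurable_fun f ->
  measurable_fun [set: measurableTypeR R * n.-tuple (measurableTypeR R)]
    (fun p => f (cV_cons p.1 (cV_of_tuple p.2))).
Proof.
move=> mf; rewrite [X in measurable_fun _ X](_ : _ = (f \o @cV_of_tuple R n.+1) \o
   (@tcons _ n)); last by apply/funext => p /=; rewrite cV_of_tuple_tcons.
by apply: measurableT_comp mf _; exact: measurable_tcons.
Qed.

Lemma cV_measurable_fun_cons d (T : measurableType d) n (f : 'cV[R]_n.+1 -> T) x :
  cV_measurable_fun f -> cV_measurable_fun (fun y => f (cV_cons x y)).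
Proof.
move=> /measurable_cV_cons mf.
exact: (measurableT_comp mf (pair1_measurable (x : measurableTypeR R))).
Qed.

Lemma measurable_fun_cons d (T : measurableType d) n (f : 'cV[R]_n.+1 -> T) y :
  cV_measurable_fun f ->
  measurable_fun [set: measurableTypeR R] (fun x => f (cV_cons x y)).
Proof.
move=> /measurable_cV_cons mf; rewrite -[y]tuple_of_cVK.
exact: (measurableT_comp mf
  (pair2_measurable (tuple_of_cV y : n.-tuple (measurableTypeR R)))).
Qed.

Lemma cV_integral_cons_pair n (f : 'cV[R]_n.+1 -> \bar R) :
  cV_measurable_fun f -> (forall x, 0 <= f x)%E ->
  cV_integral f = (\int[mu \x lebesgue_tuple R n]_p
    f (cV_cons p.1 (cV_of_tuple p.2)))%E.
Proof.
move=> mf f0; rewrite /cV_integral /lebesgue_tuple /=.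
have := @ge0_integral_pushforward _ _ _ _ R (@tcons _ n)
  (@measurable_tcons _ (measurableTypeR R) n)
  (mu \x tuple_measure mu n)%E setT (f \o @cV_of_tuple R n.+1) measurableT mf.
rewrite preimage_setT => pf.
apply: etrans (pf _) _ => [t _|]; first exact: f0.
by apply: eq_integral => p _ /=; rewrite cV_of_tuple_tcons.
Qed.

Lemma cV_integral_cons n (f : 'cV[R]_n.+1 -> \bar R) :
  cV_measurable_fun f -> (forall x, 0 <= f x)%E ->
  cV_integral f = (\int[mu]_x cV_integral (fun y => f (cV_cons x y)))%E.
Proof.
move=> mf f0; rewrite cV_integral_cons_pair//.
rewrite (fubini_tonelli1 (fun p : measurableTypeR R * n.-tuple (measurableTypeR R)
  => f (cV_cons p.1 (cV_of_tuple p.2))))//.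
exact: measurable_cV_cons.
Qed.

(** Here the first coordinate is integrated innermost, as shears and sections along the first axis
    require. *)
Lemma cV_integral_cons' n (f : 'cV[R]_n.+1 -> \bar R) :
  cV_measurable_fun f -> (forall x, 0 <= f x)%E ->
  cV_integral f = cV_integral (fun y => \int[mu]_x f (cV_cons x y))%E.
Proof.
move=> mf f0; rewrite cV_integral_cons_pair//.
rewrite (fubini_tonelli2 (fun p : measurableTypeR R * n.-tuple (measurableTypeR R)
  => f (cV_cons p.1 (cV_of_tuple p.2))))//.
exact: measurable_cV_cons.
Qed.

Lemma cV_measurable_fun_integral_cons n (f : 'cV[R]_n.+1 -> \bar R) :
  cV_measurable_fun f -> (forall x, 0 <= f x)%E ->
  cV_measurable_fun (fun y => \int[mu]_x f (cV_cons x y))%E.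
Proof.
move=> mf f0.
exact: (@measurable_fun_fubini_tonelli_G _ _ _ _ R mu _ (measurable_cV_cons mf)
  (fun p => f0 _)).
Qed.

Lemma measurable_fun_integral_cons n (f : 'cV[R]_n.+1 -> \bar R) :
  cV_measurable_fun f -> (forall x, 0 <= f x)%E ->
  measurable_fun [set: measurableTypeR R]
    (fun x => cV_integral (fun y => f (cV_cons x y)))%E.
Proof.
move=> mf f0.
exact: (@measurable_fun_fubini_tonelli_F _ _ _ _ R (lebesgue_tuple R n) _
  (measurable_cV_cons mf) (fun p => f0 _)).
Qed.

Lemma cV_integral_ext n (f g : 'cV[R]_n -> \bar R) : f =1 g ->
  cV_integral f = cV_integral g.
Proof. by move=> /funext ->. Qed.

Lemma cV_integral_ge0 n (f : 'cV[R]_n -> \bar R) : (forall x, 0 <= f x)%E ->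
  (0 <= cV_integral f)%E.
Proof. by move=> f0; apply: integral_ge0 => t _. Qed.

Lemma ge0_cV_integralZl n (f : 'cV[R]_n -> \bar R) (k : R) :
  cV_measurable_fun f -> (forall x, 0 <= f x)%E -> 0 <= k ->
  cV_integral (fun x => k%:E * f x)%E = (k%:E * cV_integral f)%E.
Proof.
move=> mf f0 k0.
by rewrite /cV_integral -ge0_integralZl_EFin// => t _; exact: f0.
Qed.

Lemma ge0_cV_integralD n (f g : 'cV[R]_n -> \bar R) :
  cV_measurable_fun f -> (forall x, 0 <= f x)%E ->
  cV_measurable_fun g -> (forall x, 0 <= g x)%E ->
  cV_integral (fun x => f x + g x)%E = (cV_integral f + cV_integral g)%E.
Proof.
by move=> mf f0 mg g0; rewrite /cV_integral -ge0_integralD.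
Qed.

Lemma ge0_le_cV_integral n (f g : 'cV[R]_n -> \bar R) :
  cV_measurable_fun f -> (forall x, 0 <= f x)%E ->
  cV_measurable_fun g -> (forall x, f x <= g x)%E ->
  (cV_integral f <= cV_integral g)%E.
Proof.
by move=> mf f0 mg fg; apply: ge0_le_integral => // t _; exact: fg.
Qed.

End integral_column_vectors.

(** * Linear change of variables *)

Section linear_change_of_variables.
Context {R : realType}.
Local Notation mu := (@lebesgue_measure R).

(** Both sides are measures in [A] that agree on half-open intervals, which determines Lebesgue
    measure. *)
Lemma lebesgue_measure_affine (a b : R) (A : set R) : 0 < a -> measurable A ->
  (a%:E * pushforward mu (fun x : measurableTypeR R => a * x + b : measurableTypeR
    R)%R A)%E = mu A.
Proof.
move=> a0 mA.
have mphi : measurable_fun [set: measurableTypeR R]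
    (fun x => a * x + b : measurableTypeR R).
  by apply: measurable_funD => //; exact: measurable_funM.
unshelve epose (P := (pushforward mu (fun x => a * x + b : measurableTypeR R)
  : {measure set _ -> \bar R})) => //.
apply/esym; apply: (@lebesgue_measure_unique R (mscale (NngNum (ltW a0)) P)) => // _
  [[u v] _ <-].
apply/esym; transitivity (a%:E * mu ((fun x => a * x + b)%R @^-1` `]u, v]))%E => //.
rewrite (_ : _ @^-1` _ = `](u - b) / a, (v - b) / a]%classic); last first.
  apply/seteqP; split => x /=; rewrite !in_itv/= ltr_pdivrMr// ler_pdivlMr//;
  by rewrite [x * a]mulrC ltrBlDr lerBrDr.
rewrite !lebesgue_measure_itv/= !lte_fin ltr_pM2r ?invr_gt0// ltrD2r.
case: ifPn => uv; last by rewrite mule0.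
rewrite -!EFinD -EFinM; congr EFin; field.
by rewrite gt_eqF.
Qed.

Lemma ge0_integral_affine_pos (a b : R) (f : R -> \bar R) : 0 < a ->
  measurable_fun [set: measurableTypeR R] f -> (forall x, 0 <= f x)%E ->
  (a%:E * \int[mu]_x f (a * x + b)%R)%E = (\int[mu]_x f x)%E.
Proof.
move=> a0 mf f0.
have mphi : measurable_fun [set: measurableTypeR R]
    (fun x => a * x + b : measurableTypeR R).
  by apply: measurable_funD => //; exact: measurable_funM.
unshelve epose (P := (pushforward mu (fun x => a * x + b : measurableTypeR R)
  : {measure set _ -> \bar R})) => //.
transitivity (\int[mscale (NngNum (ltW a0)) P]_x f x)%E; last first.
  by apply: eq_measure_integral => A mA _; exact: lebesgue_measure_affine.
by rewrite ge0_integral_mscale//= ge0_integral_pushforward//= preimage_setT.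
Qed.

Lemma ge0_integral_opp (f : R -> \bar R) :
  measurable_fun [set: measurableTypeR R] f -> (forall x, 0 <= f x)%E ->
  (\int[mu]_x f (- x)%R)%E = (\int[mu]_x f x)%E.
Proof.
move=> mf f0.
transitivity (\int[pushforward mu (-%R : _ -> measurableTypeR R)]_x f x)%E; last first.
  by apply: eq_measure_integral => A mA _; exact: lebesgue_measureN.
by rewrite ge0_integral_pushforward//= preimage_setT.
Qed.

Lemma ge0_integral_affine (a b : R) (f : R -> \bar R) : a != 0 ->
  measurable_fun [set: measurableTypeR R] f -> (forall x, 0 <= f x)%E ->
  (`|a|%:E * \int[mu]_x f (a * x + b)%R)%E = (\int[mu]_x f x)%E.
Proof.
move=> a0 mf f0; have [a_lt0|a_gt0|/eqP] := ltgtP a 0; last by rewrite (negbTE a0).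
- have -> : (\int[mu]_x f (a * x + b)%R = \int[mu]_x f (- a * x + b)%R)%E.
    rewrite -ge0_integral_opp.
    + by apply: eq_integral => x _; rewrite mulrN mulNr.
    + apply: measurableT_comp => //.
      by apply: measurable_funD => //; exact: measurable_funM.
    + by move=> x; exact: f0.
  by rewrite ltr0_norm// ge0_integral_affine_pos// oppr_gt0.
- by rewrite gtr0_norm// ge0_integral_affine_pos.
Qed.


Lemma cV_measurable_fun_addmx d (T : measurableType d) n (f : 'cV[R]_n -> T) (b :
  'cV[R]_n) :
  cV_measurable_fun f -> cV_measurable_fun (fun x => f (x + b)).
Proof.
move=> mf; apply: (@cV_measurable_fun_comp _ _ _ _ _ f (fun x => x + b)) => // i.
rewrite /cV_measurable_fun [X in measurable_fun _ X](_ : _ =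
   (fun t => tnth t i + b i 0)); last by apply/funext => t /=; rewrite !mxE.
by apply: measurable_funD => //; exact: (@measurable_tnth _ (measurableTypeR R)).
Qed.

Lemma cV_consD n x x' (y y' : 'cV[R]_n) :
  cV_cons (x + x') (y + y') = cV_cons x y + cV_cons x' y'.
Proof. apply/colP => i; rewrite [RHS]mxE; case: (unliftP ord0 i) => [j|] ->.
  by rewrite !cV_consS mxE.
by rewrite !cV_cons0. Qed.

Lemma cV_integral_translate n (f : 'cV[R]_n -> \bar R) (b : 'cV[R]_n) :
  cV_measurable_fun f -> (forall x, 0 <= f x)%E ->
  cV_integral (fun x => f (x + b)) = cV_integral f.
Proof.
elim: n f b => [|n IHn] f b mf f0.
  by apply: cV_integral_ext => x; congr f; apply/colP => -[].
rewrite [b]cV_cons_eta; set b0 := b 0 0; set b1 := \col_i _.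
have mfb := cV_measurable_fun_addmx (cV_cons b0 b1) mf.
rewrite (cV_integral_cons mf f0) (cV_integral_cons mfb (fun x => f0 _)).
transitivity (\int[mu]_x cV_integral (fun y => f (cV_cons (x + b0) y)))%E.
  apply: eq_integral => x _.
  rewrite -[RHS](IHn _ b1)//; last exact: cV_measurable_fun_cons.
  by apply: cV_integral_ext => y; rewrite cV_consD.
pose g x := cV_integral (fun y => f (cV_cons x y)).
have mg : measurable_fun [set: measurableTypeR R] g.
  exact: measurable_fun_integral_cons.
have g0 x : (0 <= g x)%E by exact: cV_integral_ge0.
apply: etrans (ge0_integral_affine b0 (oner_neq0 R) mg g0).
rewrite normr1 mul1e; apply: eq_integral => x _.
by rewrite /g mul1r.
Qed.

(** Change of variables as a property of the matrix: it is closed under products, so elementary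
    factors suffice. *)
Definition scales_integral n (M : 'M[R]_n) := forall f : 'cV[R]_n -> \bar R,
  cV_measurable_fun f -> (forall x, 0 <= f x)%E ->
  (`|\det M|%:E * cV_integral (fun x => f (M *m x)))%E = cV_integral f.

Lemma scales_integralM n (A B : 'M[R]_n) :
  scales_integral A -> scales_integral B -> scales_integral (A *m B).
Proof.
move=> sA sB f mf f0; rewrite -(sA f)//.
rewrite -(sB (fun x => f (A *m x)))//; last exact: cV_measurable_fun_mulmx.
rewrite det_mulmx normrM EFinM -muleA; do 2 congr (_ * _)%E.
by apply: cV_integral_ext => x; rewrite mulmxA.
Qed.

(** For fixed lower coordinates the matrix acts on the first one as an affine map of slope [a]. *)
Lemma scales_integral_upper n (a : R) (r : 'rV[R]_n) : a != 0 ->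
  scales_integral (block_mx (a%:M : 'M[R]_1) r 0 1%:M : 'M[R]_n.+1).
Proof.
move=> a0 f mf f0; set M := block_mx _ _ _ _.
have ME x y : M *m cV_cons x y = cV_cons (a * x + (r *m y) 0 0) y.
  rewrite /M /cV_cons (mul_block_col a%:M r 0 1%:M x%:M y) mul0mx add0r mul1mx.
  by rewrite -scalar_mxM [in LHS](mx11_scalar (r *m y)) -raddfD.
have -> : \det M = a by rewrite /M (det_ublock a%:M r 1%:M) det1 mulr1 det_scalar1.
have mfM := cV_measurable_fun_mulmx M mf.
rewrite !cV_integral_cons'// -ge0_cV_integralZl//.
- apply: cV_integral_ext => y; under eq_integral do rewrite ME.
  rewrite (@ge0_integral_affine a _ (fun x => f (cV_cons x y)))//.
  by have := measurable_fun_cons y mf.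
- by apply: (cV_measurable_fun_integral_cons mfM) => x; exact: f0.
- by move=> y; apply: integral_ge0 => x _.
Qed.

(** For a fixed first coordinate the matrix acts on the others as [A] followed by a translation. *)
Lemma scales_integral_lower n (b : 'cV[R]_n) (A : 'M[R]_n) : scales_integral A ->
  scales_integral (block_mx (1%:M : 'M[R]_1) 0 b A : 'M[R]_n.+1).
Proof.
move=> sA f mf f0; set M := block_mx _ _ _ _.
have ME x y : M *m cV_cons x y = cV_cons x (A *m y + x *: b).
  rewrite /M /cV_cons (mul_block_col 1%:M 0 b A x%:M y) mul0mx addr0 mul1mx.
  by rewrite mul_mx_scalar addrC.
have -> : \det M = \det A by rewrite /M (det_lblock 1%:M b A) det1 mul1r.
have mfM := cV_measurable_fun_mulmx M mf.
rewrite !cV_integral_cons// -ge0_integralZl_EFin//.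
- apply: eq_integral => x _; under cV_integral_ext do rewrite ME.
  have mfx := cV_measurable_fun_cons x mf.
  rewrite (sA (fun y => f (cV_cons x (y + x *: b))))//; last first.
    exact: (cV_measurable_fun_addmx _ mfx).
  by rewrite (cV_integral_translate _ mfx).
- by move=> x _; exact: cV_integral_ge0.
- by apply: (measurable_fun_integral_cons mfM) => x; exact: f0.
Qed.

(* Induction on [n]: up to a shear that makes the corner nonzero, M factors as a
   lower block-triangular matrix times a shear and scaling of the first axis. *)
Lemma scales_integral_unitmx n (M : 'M[R]_n) : M \in unitmx -> scales_integral M.
Proof.
elim: n M => [|n IHn] M Mu.
  move=> f mf f0; rewrite det_mx00 normr1 mul1e; apply: cV_integral_ext => x.
  by congr f; apply/colP => -[].
have lu (N : 'M[R]_(1 + n)) : N \in unitmx -> N 0 0 != 0 -> @scales_integral n.+1 N.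
  move=> Nu N0; pose a : R := N 0 0.
  (* [S] is the Schur complement of the corner [a]. *)
  pose r := ursubmx N; pose b := dlsubmx N; pose S := drsubmx N - a^-1 *: (b *m r).
  have NE : N = block_mx 1%:M 0 (a^-1 *: b) S *m block_mx (a%:M : 'M[R]_1) r 0 1%:M.
    rewrite mulmx_block !mul1mx !mul0mx !mulmx0 !mulmx1 !addr0.
    rewrite mul_mx_scalar scalerA mulfV// scale1r -scalemxAl addrC subrK.
    rewrite -[LHS]submxK; congr block_mx; rewrite [LHS]mx11_scalar; congr (_%:M).
    by rewrite !mxE /a; congr (N _ _); exact: val_inj.
  rewrite NE; apply: scales_integralM; last exact: scales_integral_upper.
  apply: scales_integral_lower; apply: IHn.
  move: Nu; rewrite NE unitmx_mul => /andP[+ _].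
  by rewrite !unitmxE (det_lblock 1%:M _ S) det1 mul1r.
have [M0|M0] := eqVneq (M 0 0) 0; last exact: lu.
have [j Mj] : exists j : 'I_n, M (lift 0 j) 0 != 0.
  apply/existsP; apply: contraTT Mu => /existsPn M'.
  rewrite unitmxE unitfE negbK (expand_det_col _ 0) big1// => i _.
  case: (unliftP 0 i) => [j|] ->; last by rewrite M0 mul0r.
  by have := M' j; rewrite negbK => /eqP ->; rewrite mul0r.
pose U (c : R) : 'M[R]_(1 + n) := block_mx (1%:M : 'M[R]_1) (c *: delta_mx 0 j) 0 1%:M.
have UK c : U (- c) *m U c = 1%:M.
  rewrite /U (mulmx_block 1%:M _ 0 1%:M 1%:M _ 0 1%:M).
  rewrite !mul1mx !mul0mx !mulmx0 !mulmx1 !addr0 add0r -scalerDl subrr scale0r.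
  by rewrite -(scalar_mx_block _ _ 1).
have -> : M = U (- 1) *m (U 1 *m (M : 'M[R]_(1 + n))) by rewrite mulmxA UK mul1mx.
apply: scales_integralM.
  exact: scales_integral_upper (oner_neq0 R).
apply: lu.
  rewrite unitmx_mul Mu andbT unitmxE /U (det_ublock 1%:M _ 1%:M) !det1 mulr1.
  exact: unitr1.
have U1 i : U 1 0 (lift 0 i) = (i == j)%:R.
  transitivity (U 1 (lshift n 0) (rshift 1 i)).
    by congr (U 1 _ _); exact: val_inj.
  by rewrite /U block_mxEur scale1r mxE eqxx.
rewrite mxE (bigD1 (lift 0 j))//= U1 eqxx mul1r big1 ?addr0// => i.
case: (unliftP 0 i) => [k|] ->; last by rewrite M0 mulr0.
by rewrite (inj_eq lift_inj) => /negbTE kj; rewrite U1 kj mul0r.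
Qed.

End linear_change_of_variables.

(** * Measurable sets, volumes and product integrals *)

Section measurable_sets_of_column_vectors.
Context {R : realType}.

Lemma cV_measurable_cube n (c : 'cV[R]_n) (e : R) :
  cV_measurable [set x | forall i, `|c i 0 - x i 0| < e].
Proof.
rewrite /cV_measurable (_ : _ @^-1` _ = \big[setI/setT]_(i < n)
   ((fun t => tnth t i) @^-1` (ball (c i 0) e))); last first.
  apply/seteqP; split=> [t /= At|t].
    by elim/big_ind : _ => //= i _; have := At i; rewrite mxE.
  by move=> + i /=; rewrite (bigD1 i)//= mxE => -[].
apply: bigsetI_measurable => i _; rewrite -[X in measurable X]setTI.
by apply: (@measurable_tnth _ (measurableTypeR R)) => //; exact: measurable_ball.
Qed.

(** An open set is the union of the countably many cubes with rational center and radius 1/(k+1)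
    that it contains. *)
Lemma open_cV_measurable n (A : set 'cV[R]_n) : open A -> cV_measurable A.
Proof.
move=> oA; rewrite /cV_measurable.
pose c (q : {ffun 'I_n -> rat}) : 'cV[R]_n := \col_i ratr (q i).
pose B (p : {ffun 'I_n -> rat} * nat) : set 'cV[R]_n :=
  [set x | forall i, `|c p.1 i 0 - x i 0| < p.2.+1%:R^-1].
pose F p := if pselect (B p `<=` A) then @cV_of_tuple R n @^-1` B p else set0.
rewrite (_ : _ @^-1` _ = \bigcup_p F p).
  apply: countable_bigcupT_measurable; first exact: countableP.
  by move=> p; rewrite /F; case: pselect => ?; [exact: cV_measurable_cube|exact:
    measurable0].
apply/seteqP; split=> [t At|t [p _]]; last first.
  by rewrite /F; case: pselect => // pA Bt; exact: (pA _ Bt).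
have : nbhs (cV_of_tuple t) A by exact: open_nbhs_nbhs.
move=> /nbhs_ballP[e /= e0 eA].
(* With 1/(k+1) < e/2, a cube of radius 1/(k+1) centered that close to the point contains it and
   stays in the [e]-ball around it. *)
pose k := Num.truncn (2 / e).
have ke : k.+1%:R^-1 < e / 2.
  by rewrite -ltf_pV2 ?posrE ?divr_gt0 ?invr_gt0// invrK invf_div truncnS_gt.
have k0 : 0 < k.+1%:R^-1 :> R by rewrite invr_gt0.
have /choice[q qt] : forall i, exists q : rat,
    `|ratr q - cV_of_tuple t i 0| < k.+1%:R^-1.
  move=> i; have /rat_in_itvoo[q] : cV_of_tuple t i 0 - k.+1%:R^-1 < cV_of_tuple t i
    0 + k.+1%:R^-1.
    by rewrite ltrD2l gtrN.
  by rewrite in_itv/= => qi; exists q; rewrite ltr_distl.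
exists ([ffun i => q i], k) => //; rewrite /F; case: pselect => [?|[]].
  by move=> i /=; rewrite mxE ffunE.
move=> x /= Bx; apply: eA; split=> // i j; rewrite ord1 /ball/=.
have := qt i; have := Bx i; rewrite mxE ffunE => h1 h2.
rewrite (le_lt_trans (ler_distD (ratr (q i)) _ _))// [e]splitr ltrD//.
  by rewrite distrC (lt_trans h2).
by rewrite (lt_trans h1).
Qed.

Lemma closed_cV_measurable n (A : set 'cV[R]_n) : closed A -> cV_measurable A.
Proof.
move=> cA; rewrite /cV_measurable -[A]setCK preimage_setC; apply: measurableC.
by have := open_cV_measurable (closed_openC cA).
Qed.

(** The source consists of row vectors because compactness of boxes, [rV_compact], is stated for
    them. *)
Lemma continuous_mulmx_tr m n (M : 'M[R]_(m, n)) :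
  continuous (fun v : 'rV[R]_n => M *m v^T : 'cV[R]_m).
Proof.
move=> v; have FF : Filter (nbhs v) := @nbhs_filter 'rV[R]_n v.
apply/cvgrPdist_lt => e e0.
(* The summand 1 keeps [C] positive when [M] is zero. *)
pose C := 1 + \sum_i \sum_j `|M i j|.
have C0 : 0 < C.
  by rewrite ltr_pwDl// sumr_ge0// => i _; rewrite sumr_ge0.
have : \forall w \near v, `|v - w| < e / C.
  have eC : 0 < e / C by rewrite divr_gt0.
  apply/nbhs_ballP; exists (e / C) => // w; rewrite mx_norm_ball.
  by [].
apply: filterS => w vw; rewrite -mulmxBr -raddfB.
rewrite [ltLHS]mx_normrE; apply/bigmax_ltP; split => // -[i j] _ /=.
rewrite mxE (le_lt_trans (ler_norm_sum _ _ _))//.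
apply: (@le_lt_trans _ _ (C * `|v - w|)); last by rewrite mulrC -ltr_pdivlMr.
rewrite mulrDl mul1r ler_wpDl// (bigD1 i)//= mulrDl ler_wpDr//.
  by rewrite mulr_ge0// sumr_ge0// => k _; rewrite sumr_ge0.
rewrite mulr_suml ler_sum// => k _; rewrite normrM ler_wpM2l// [j]ord1.
rewrite [leRHS]mx_normrE; apply/bigmax_geP; right; exists (0, k) => //=.
by rewrite !mxE.
Qed.

Lemma compact_linear_image m n (M : 'M[R]_(m, n)) (C : set 'rV[R]_n) :
  compact C -> compact [set M *m v^T | v in C].
Proof.
move=> cC; apply: continuous_compact => //; apply: continuous_subspaceT.
exact: continuous_mulmx_tr.
Qed.

Lemma compact_cV_measurable n (A : set 'cV[R]_n) : compact A -> cV_measurable A.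
Proof.
move=> cA; apply: closed_cV_measurable; apply: compact_closed cA.
exact: norm_hausdorff.
Qed.

Lemma cV_measurable_indic n (A : set 'cV[R]_n) : cV_measurable A ->
  cV_measurable_fun (fun x => (\1_A x : R)%:E).
Proof.
move=> mA; apply/measurable_EFinP.
rewrite [X in measurable_fun _ X](_ : _ = \1_(@cV_of_tuple R n @^-1` A)).
  exact: measurable_indic.
by apply/funext => t.
Qed.

Lemma volume_integral n (A : set 'cV[R]_n) : cV_measurable A ->
  volume A = cV_integral (fun x => (\1_A x : R)%:E).
Proof.
move=> mA; rewrite /volume.
have := @integral_indic _ _ _ (lebesgue_tuple R n) setT measurableT _ mA.
by rewrite setIT => <-.
Qed.

Lemma cV_measurable_image_unitmx n (M : 'M[R]_n) (A : set 'cV[R]_n) :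
  M \in unitmx -> cV_measurable A -> cV_measurable [set M *m x | x in A].
Proof.
move=> Mu mA.
have -> : [set M *m x | x in A] = (fun x => invmx M *m x) @^-1` A.
  apply/seteqP; split => [_ /= [x Ax <-]|x /= Ax]; first by rewrite mulKmx.
  by exists (invmx M *m x) => //; rewrite mulKVmx.
have mA1 : cV_measurable_fun (\1_A : 'cV[R]_n -> R).
  exact: (@measurable_indic _ _ _ _ (@cV_of_tuple R n @^-1` A)).
have := cV_measurable_fun_mulmx (invmx M) mA1.
move=> /(_ measurableT _ (measurable_set1 1)).
rewrite setTI; congr (measurable _); apply/seteqP; split => t /=.
  rewrite indicE; case: (boolP (_ \in A)) => [/set_mem//|_ /eqP].
  by rewrite eq_sym oner_eq0.
by move=> At; rewrite indicE mem_set.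
Qed.

Lemma volume_image_unitmx n (M : 'M[R]_n) (A : set 'cV[R]_n) :
  M \in unitmx -> cV_measurable A ->
  volume [set M *m x | x in A] = (`|\det M|%:E * volume A)%E.
Proof.
move=> Mu mA; have mMA := cV_measurable_image_unitmx Mu mA.
rewrite !volume_integral//.
rewrite -(scales_integral_unitmx Mu)//; last exact: cV_measurable_indic.
congr (_ * _)%E; apply: cV_integral_ext => x; rewrite !indicE; congr (_%:R%:E).
congr (nat_of_bool _); apply/idP/idP => /set_mem.
  by move=> [y Ay /(can_inj (mulKmx Mu)) <-]; exact: mem_set.
by move=> Ax; apply: mem_set; exists x.
Qed.

Lemma le_volume n (A B : set 'cV[R]_n) : cV_measurable A -> cV_measurable B ->
  A `<=` B -> (volume A <= volume B)%E.
Proof.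
by move=> mA mB AB; apply: le_measure; rewrite ?inE// => t /AB.
Qed.

Lemma volume_scale n (A : set 'cV[R]_n) (r : R) : 0 < r -> cV_measurable A ->
  volume [set r *: x | x in A] = ((r ^+ n)%:E * volume A)%E.
Proof.
move=> r0 mA; have ru : r%:M \in @unitmx R n.
  by rewrite unitmxE det_scalar unitrX// unitfE gt_eqF.
rewrite (_ : [set _ | _ in _] = [set r%:M *m x | x in A]).
  by rewrite volume_image_unitmx// det_scalar normrX gtr0_norm.
by apply: eq_imagel => x _; rewrite mul_scalar_mx.
Qed.

Lemma cV_measurable_scale n (A : set 'cV[R]_n) (r : R) : 0 < r ->
  cV_measurable A -> cV_measurable [set r *: x | x in A].
Proof.
move=> r0 mA; have ru : r%:M \in @unitmx R n.
  by rewrite unitmxE det_scalar unitrX// unitfE gt_eqF.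
rewrite (_ : [set _ | _ in _] = [set r%:M *m x | x in A]).
  exact: cV_measurable_image_unitmx.
by apply: eq_imagel => x _; rewrite mul_scalar_mx.
Qed.

End measurable_sets_of_column_vectors.

(** * Integrals of products of one-variable functions *)

Section product_integral.
Context {R : realType}.
Local Notation mu := (@lebesgue_measure R).

Lemma cV_measurable_prod n (F : 'I_n -> R -> R) :
  (forall i, measurable_fun [set: measurableTypeR R] (F i)) ->
  cV_measurable_fun (fun x : 'cV[R]_n => \prod_i F i (x i 0)).
Proof.
move=> mF; rewrite /cV_measurable_fun.
apply: (@measurable_prod _ _ _ _ _ _ (fun i t => F i (cV_of_tuple t i 0))).
move=> i _; apply: (measurableT_comp (mF i)).
exact: cV_measurable_fun_coord.
Qed.

Lemma cV_integral_prod n (F : 'I_n -> R -> R) :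
  (forall i, measurable_fun [set: measurableTypeR R] (F i)) ->
  (forall i x, 0 <= F i x) ->
  cV_integral (fun x => (\prod_i F i (x i 0))%:E) =
  (\prod_i \int[mu]_x (F i x)%:E)%E.
Proof.
elim: n F => [|n IHn] F mF F0.
  rewrite big_ord0 /cV_integral /=.
  under eq_integral do rewrite big_ord0.
  by rewrite integral_dirac// diracT mul1e.
have mP := cV_measurable_prod mF.
rewrite big_ord_recl cV_integral_cons; last 2 first.
- exact/measurable_EFinP.
- by move=> x; rewrite lee_fin prodr_ge0.
rewrite -IHn//; set I := cV_integral _.
rewrite -ge0_integralZr//.
- apply: eq_integral => x _; rewrite -ge0_cV_integralZl//.
  + apply: cV_integral_ext => y; rewrite big_ord_recl EFinM cV_cons0.
    by congr (_ * (_)%:E)%E; apply: eq_bigr => i _; rewrite cV_consS.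
  + apply/measurable_EFinP.
    exact: (@cV_measurable_prod n (fun i => F (lift ord0 i))).
  + by move=> y; rewrite lee_fin prodr_ge0.
- exact/measurable_EFinP.
- by move=> x _; rewrite lee_fin.
- by apply: cV_integral_ge0 => y; rewrite lee_fin prodr_ge0.
Qed.

End product_integral.

(** * Volumes of zonotopes *)

Section thickened_interval.
Context {R : realType}.
Local Notation mu := (@lebesgue_measure R).

Lemma lebesgue_measure_between_itv (A : set R) (a b : R) : a <= b ->
  `]a, b[ `<=` A -> A `<=` `[a, b] -> mu A = (b - a)%:E.
Proof.
move=> ab oA Ac.
have mA : measurable A.
  (* A set between an open interval and its closure is an interval, hence measurable. *)
  apply: is_interval_measurable => x y Ax Ay z /andP[xz zy].
  have := Ac _ Ax; rewrite /= in_itv/= => /andP[ax xb].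
  have := Ac _ Ay; rewrite /= in_itv/= => /andP[ay yb].
  have [xz'|] := ltP x z; last by move=> zx; rewrite (_ : z = x)//; apply/eqP;
    rewrite eq_le zx.
  have [zy'|] := ltP z y; last by move=> yz; rewrite (_ : z = y)//; apply/eqP;
    rewrite eq_le zy.
  by apply: oA; rewrite /= in_itv/= (le_lt_trans ax)// (lt_le_trans zy').
have itvE b1 b2 : mu [set` Interval (BSide b1 a) (BSide b2 b)] = (b - a)%:E.
  rewrite lebesgue_measure_itv/= lte_fin; case: ltP => //= ba.
  by rewrite (_ : b = a) ?subrr//; apply/eqP; rewrite eq_le ba.
apply/eqP; rewrite eq_le; apply/andP; split.
  by rewrite -(itvE true false); apply: le_measure; rewrite ?inE.
by rewrite -(itvE false true); apply: le_measure; rewrite ?inE.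
Qed.

(** Adding [-1, 1] moves each end outwards by 1. [S] may or may not contain its infimum and
    supremum, so both sets are only squeezed between open and closed intervals. *)
Lemma lebesgue_measure_thicken (S : set R) : is_interval S -> S !=set0 ->
  has_lbound S -> has_ubound S ->
  mu [set x | exists2 t, `|t| <= 1 & S (x - t)] = (mu S + 2%:E)%E.
Proof.
move=> iS S0 lS uS; have [s Ss] := S0.
have is_ : inf S <= s by exact: ge_inf.
have ss : s <= sup S by exact: ub_le_sup.
have above x : x < sup S -> exists2 y, S y & x < y by exact: sup_gt.
have below x : inf S < x -> exists2 y, S y & y < x by exact: inf_lt.
rewrite (@lebesgue_measure_between_itv _ (inf S - 1) (sup S + 1)).
- rewrite (@lebesgue_measure_between_itv _ (inf S) (sup S)).
  + by rewrite -EFinD; congr EFin; lra.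
  + exact: le_trans ss.
  + move=> x /=; rewrite in_itv/= => /andP[/below[y Sy yx] /above[z Sz xz]].
    by apply: (iS y z) => //; rewrite !ltW.
  + move=> x Sx /=; rewrite in_itv/=; apply/andP; split; first exact: ge_inf.
    exact: ub_le_sup.
- lra.
- move=> x /=; rewrite in_itv/= => /andP[ix xs].
  have [y Sy yx] : exists2 y, S y & y < x + 1 by apply: below; lra.
  have [z Sz xz] : exists2 z, S z & x - 1 < z by apply: above; lra.
  (* Either [y] or [z] is within distance 1 of [x], or [x] lies between them and belongs to [S]
     itself. *)
  suff [w Sw wx] : exists2 w, S w & x - 1 <= w <= x + 1.
    exists (x - w); last by rewrite opprB addrC subrK.
    by rewrite ler_norml; apply/andP; split; lra.
  have [xy|yx'] := leP (x - 1) y; first by exists y => //; apply/andP; split; lra.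
  have [zx|xz'] := leP z (x + 1); first by exists z => //; apply/andP; split; lra.
  exists x; last by apply/andP; split; lra.
  by apply: (iS y z) => //; apply/andP; split; lra.
- move=> x /= [t t1 Sxt]; rewrite in_itv/=.
  have h1 : inf S <= x - t by exact: ge_inf.
  have h2 : x - t <= sup S by exact: ub_le_sup.
  by move: t1; rewrite ler_norml => /andP[? ?]; apply/andP; split; lra.
Qed.

End thickened_interval.

Section zonotope.
Context {R : realType}.
Local Notation mu := (@lebesgue_measure R).

Definition zonotope (J : finType) n (v : J -> 'cV[R]_n) : set 'cV[R]_n :=
  [set x | exists2 t : J -> R, (forall j, `|t j| <= 1) & x = \sum_j t j *: v j].

Lemma compact_zonotope (J : finType) n (v : J -> 'cV[R]_n) : compact (zonotope v).
Proof.
pose C := [set t : 'rV[R]_#|J| | forall i, t ord0 i \in `[-1, 1]].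
have cC : compact C.
  have := (@rV_compact R #|J| (fun=> `[-1, 1]%classic)).
  apply=> i; exact: segment_compact.
pose M : 'M[R]_(n, #|J|) := \matrix_(i, k) v (enum_val k) i 0.
rewrite (_ : zonotope v = [set M *m t^T | t in C]).
  exact: compact_linear_image.
apply/seteqP; split => [x [t t1 ->]|x [t /= Ct <-]].
- exists (\row_k t (enum_val k)).
    by move=> k /=; rewrite mxE in_itv/= -ler_norml t1.
  apply/colP => i; rewrite mxE summxE [RHS](reindex _ (onW_bij _ (@enum_val_bij J)))/=.
  by apply: eq_bigr => k _; rewrite !mxE mulrC.
- exists (fun j => t ord0 (enum_rank j)).
    by move=> j; have := Ct (enum_rank j); rewrite in_itv/= ler_norml.
  apply/colP => i; rewrite mxE summxE [RHS](reindex _ (onW_bij _ (@enum_val_bij J)))/=.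
  by apply: eq_bigr => k _; rewrite !mxE enum_valK mulrC.
Qed.

Lemma cV_measurable_zonotope (J : finType) n (v : J -> 'cV[R]_n) :
  cV_measurable (zonotope v).
Proof. by apply: compact_cV_measurable; exact: compact_zonotope. Qed.

Lemma zonotope_mulmx (J : finType) m n (M : 'M[R]_(m, n)) (v : J -> 'cV[R]_n) :
  [set M *m x | x in zonotope v] = zonotope (fun j => M *m v j).
Proof.
have E (t : J -> R) : M *m (\sum_j t j *: v j) = \sum_j t j *: (M *m v j).
  by rewrite mulmx_sumr; apply: eq_bigr => j _; rewrite scalemxAr.
apply/seteqP; split=> [_ [x [t t1 ->] <-]|_ [t t1 ->]].
  by exists t.
by exists (\sum_j t j *: v j); [exists t|].
Qed.

Lemma zonotope_convex (J : finType) n (v : J -> 'cV[R]_n) s x y : 0 <= s <= 1 ->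
  zonotope v x -> zonotope v y -> zonotope v (s *: x + (1 - s) *: y).
Proof.
move=> /andP[s0 s1] [t t1 ->] [r r1 ->].
exists (fun j => s * t j + (1 - s) * r j) => [j|].
  rewrite (le_trans (ler_normD _ _))// !normrM ger0_norm// (ger0_norm (x := 1 - s))
    ?subr_ge0//.
  have := t1 j; have := r1 j; nra.
rewrite !scaler_sumr -big_split/=; apply: eq_bigr => j _.
by rewrite !scalerA -scalerDl.
Qed.

Lemma zonotope_bounded (J : finType) n (v : J -> 'cV[R]_n) x i :
  zonotope v x -> `|x i 0| <= \sum_j `|v j i 0|.
Proof.
move=> [t t1 ->]; rewrite summxE (le_trans (ler_norm_sum _ _ _))//.
by apply: ler_sum => j _; rewrite !mxE normrM ler_piMl.
Qed.

Definition rows_of (J : finType) n (v : J -> 'cV[R]_n) (h : 'I_n -> J) : 'M[R]_n :=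
  \matrix_(k, i) v (h k) i 0.

(* The sections of the zonotope along the first axis are intervals, and the
   generator [u a] lengthens each nonempty one by 2; the nonempty sections are
   those over the projection of the zonotope. *)
Lemma volume_thicken_zonotope (J : finType) n (u : J -> 'cV[R]_n.+1) (a : J) :
  u a = cV_cons 1 0 ->
  volume (zonotope u) =
  (volume (zonotope (fun j => if j == a then 0 else u j)%R) +
   2%:E * volume (zonotope (fun j => \col_i u j (lift ord0 i) 0)%R))%E.
Proof.
move=> ua; set u' := fun j => _; set w := fun j => _.
have sumE t : \sum_j t j *: u j = cV_cons (t a) 0 + \sum_j t j *: u' j.
  rewrite (bigD1 a)//= [in RHS](bigD1 a)//= /u' eqxx scaler0 add0r.
  congr (_ + _); last by apply: eq_bigr => j /negbTE ->.
  rewrite ua; apply/colP => i; rewrite mxE; case: (unliftP ord0 i) => [k|] ->.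
    by rewrite !cV_consS !mxE mulr0.
  by rewrite !cV_cons0 mulr1.
have uE x y : zonotope u (cV_cons x y) <->
    exists2 t, `|t| <= 1 & zonotope u' (cV_cons (x - t) y).
  split=> [[t t1 E]|[s s1 [t t1 E]]].
    exists (t a) => //; exists t => //.
    apply: (addrI (cV_cons (t a) 0)); rewrite -sumE -E -cV_consD add0r.
    by rewrite addrC subrK.
  exists (fun j => if j == a then s else t j).
    by move=> j; case: eqP.
  rewrite sumE eqxx.
  rewrite (_ : \sum_j _ = \sum_j t j *: u' j); last first.
    by apply: eq_bigr => j _; rewrite /u'; case: eqP; rewrite ?scaler0.
  by rewrite -E -cV_consD add0r addrC subrK.
have wE y : zonotope w y <-> exists x, zonotope u' (cV_cons x y).
  split=> [[t t1 ->]|[x [t t1 E]]].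
    exists ((\sum_j t j *: u' j) 0 0); exists t => //.
    apply/colP => i; case: (unliftP ord0 i) => [k|] ->; last by rewrite cV_cons0.
    rewrite cV_consS !summxE; apply: eq_bigr => j _; rewrite !mxE /u'.
    by case: eqP => // ->; rewrite ua cV_consS !mxE.
  exists t => //; apply/colP => i.
  have /(congr1 (fun z : 'cV[R]_n.+1 => z (lift ord0 i) 0)) := E.
  rewrite cV_consS => ->; rewrite !summxE; apply: eq_bigr => j _; rewrite !mxE /u'.
  by case: eqP => // ->; rewrite ua cV_consS !mxE.
pose sec (z : J -> 'cV[R]_n.+1) y : set R := [set x | zonotope z (cV_cons x y)].
have secE z y : mu (sec z y) = (\int[mu]_x (\1_(zonotope z) (cV_cons x y) : R)%:E)%E.
  have := @integral_indic _ _ _ mu setT measurableT (sec z y).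
  rewrite setIT => <-//.
  have := measurable_fun_cons y (cV_measurable_indic (cV_measurable_zonotope z)).
  move=> /measurable_EFinP /(_ measurableT _ (measurable_set1 1)).
  rewrite setTI; congr (measurable _); apply/seteqP; split => x /=.
    rewrite indicE; case: (boolP (_ \in _)) => [/set_mem//|_ /eqP].
    by rewrite eq_sym oner_eq0.
  by move=> zx; rewrite indicE mem_set.
have mindic (z : J -> 'cV[R]_n.+1) := cV_measurable_indic (cV_measurable_zonotope z).
have intE (z : J -> 'cV[R]_n.+1) :
    volume (zonotope z) = cV_integral (fun y => mu (sec z y)).
  rewrite volume_integral ?cV_integral_cons'//; last exact: cV_measurable_zonotope.
  by apply: cV_integral_ext => y; rewrite secE.
have msec (z : J -> 'cV[R]_n.+1) : cV_measurable_fun (fun y => mu (sec z y)).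
  have -> := funext (secE z).
  by apply: (cV_measurable_fun_integral_cons (mindic z)) => x; rewrite lee_fin.
rewrite (intE u) (intE u').
have mw := cV_measurable_zonotope w.
rewrite volume_integral//.
transitivity (cV_integral (fun y => mu (sec u' y) + 2%:E * (\1_(zonotope w) y :
  R)%:E))%E; last first.
  have m2 : cV_measurable_fun (fun y => 2%:E * (\1_(zonotope w) y : R)%:E)%E.
    by apply: emeasurable_funM => //; exact: cV_measurable_indic.
  rewrite ge0_cV_integralD//.
  by rewrite ge0_cV_integralZl//; exact: cV_measurable_indic.
apply: cV_integral_ext => y.
have sec_thicken : sec u y = [set x | exists2 t, `|t| <= 1 & sec u' y (x - t)].
  by apply/seteqP; split => x /uE.
rewrite indicE; case: (boolP (y \in zonotope w)) => [/set_mem/wE[x0 ux0]|/negP yw].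
- rewrite mule1 sec_thicken; apply: lebesgue_measure_thicken.
  + move=> x1 x2 z1 z2 x /andP[x1x xx2].
    have [x12|x12] := leP x2 x1.
      by rewrite (_ : x = x1)//; apply/eqP; rewrite eq_le x1x (le_trans xx2).
    (* The weight for which s x1 + (1 - s) x2 = x. *)
    pose s := (x2 - x) / (x2 - x1).
    have s01 : 0 <= s <= 1.
      by apply/andP; split; [rewrite divr_ge0//; lra|rewrite ler_pdivrMr; lra].
    have := zonotope_convex s01 z1 z2; rewrite /sec/=; congr (zonotope _ _).
    apply/colP => i; rewrite [LHS]mxE [X in X + _]mxE [X in _ + X]mxE.
    case: (unliftP ord0 i) => [k|] ->; rewrite ?cV_consS ?cV_cons0.
      by rewrite -mulrDl addrC subrK mul1r.
    by rewrite /s; field; rewrite subr_eq0 gt_eqF.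
  + by exists x0.
  + exists (- \sum_j `|u' j 0 0|) => x /(zonotope_bounded 0).
    by rewrite cV_cons0 ler_norml => /andP[].
  + exists (\sum_j `|u' j 0 0|) => x /(zonotope_bounded 0).
    by rewrite cV_cons0 ler_norml => /andP[].
- rewrite mule0 adde0.
  have u'0 : sec u' y = set0.
    by apply/seteqP; split=> // x u'x; apply: yw; apply/mem_set/wE; exists x.
  rewrite sec_thicken u'0 measure0; rewrite -[RHS](measure0 mu); congr (mu _);
    apply/seteqP; split => // x [t _ ].
  by [].
Qed.

End zonotope.

(** * The determinant formula for the volume of a zonotope *)

Section volume_of_zonotopes.
Context {R : realType}.

(** In the rank factorization of a nonzero column the right factor is a nonzero 1 x 1 matrix, so
    inverting the left factor and rescaling gives [N]. *)
Lemma exists_unitmx_to_basis n (v : 'cV[R]_n.+1) : v != 0 ->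
  exists2 N : 'M[R]_n.+1, N \in unitmx & N *m v = cV_cons 1 0.
Proof.
move=> v0; have rv : \rank v = 1%N.
  apply/eqP; rewrite eqn_leq rank_leq_col/= lt0n mxrank_eq0//.
have := mulmx_ebase v; rewrite rv.
set C := col_ebase v; set r := row_ebase v => vE.
have Cu : C \in unitmx by exact: col_ebase_unit.
have ru : r \in unitmx by exact: row_ebase_unit.
have r0 : r 0 0 != 0 by move: ru; rewrite unitmxE det_mx11 unitfE.
have := mx11_scalar r; move: r0; set c := r 0 0 => r0 rE.
exists (c^-1 *: invmx C).
  by rewrite unitmxZ ?unitmx_inv// unitfE invr_neq0.
rewrite -[in LHS]vE -scalemxAl -mulmxA mulKmx// rE mul_mx_scalar.
rewrite scalerA mulVf// scale1r; apply/colP => i; rewrite mxE.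
case: (unliftP ord0 i) => [k|] ->; first by rewrite cV_consS mxE.
by rewrite cV_cons0.
Qed.

(** The sum runs over all maps [h]: noninjective ones contribute 0 and each n-element set of
    generators is counted n! times, whence the division by n! in [volume_zonotope]. *)
Definition det_sum (J : finType) n (v : J -> 'cV[R]_n) : R :=
  \sum_(h : {ffun 'I_n -> J}) `|\det (rows_of v h)|.

Lemma det_sum_mulmx (J : finType) n (M : 'M[R]_n) (v : J -> 'cV[R]_n) :
  det_sum (fun j => M *m v j) = `|\det M| * det_sum v.
Proof.
rewrite /det_sum mulr_sumr; apply: eq_bigr => h _.
rewrite -normrM -(det_tr M) mulrC -det_mulmx; congr (`|\det _|).
apply/matrixP => k i; rewrite !mxE; apply: eq_bigr => j _.
by rewrite !mxE mulrC.
Qed.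

(** The algebraic counterpart of [volume_thicken_zonotope]. A selection avoiding [a] does not see
    the change at [a]; one taking [a] twice has two equal rows; one taking [a] once, at any of n+1
    positions, expands along that row into a determinant of projected generators. *)
Lemma det_sum_split (J : finType) n (u : J -> 'cV[R]_n.+1) (a : J) :
  u a = cV_cons 1 0 ->
  det_sum u = det_sum (fun j => if j == a then 0 else u j) +
    n.+1%:R * det_sum (fun j => \col_i u j (lift ord0 i) 0 : 'cV[R]_n).
Proof.
move=> ua; set u' := fun j => _; set w := fun j => _.
have hit (h : {ffun 'I_n.+1 -> J}) :
    `|\det (rows_of u h)| = `|\det (rows_of u' h)| +
      \sum_(k | h k == a) `|\det (rows_of u h)|.
  have [/existsP[k hk]|/existsPn nh] := boolP [exists k, h k == a]; last first.
    rewrite [X in _ + X]big1 ?addr0; last by move=> k hk; have := nh k; rewrite hk.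
    congr (`|\det _|); apply/matrixP => k i; rewrite !mxE /u'.
    by have /negbTE -> := nh k.
  rewrite (_ : \det (rows_of u' h) = 0) ?normr0 ?add0r; last first.
    rewrite (expand_det_row _ k) big1// => i _.
    by rewrite mxE /u' hk mxE mul0r.
  have [/existsP[l /andP[lk hl]]|/existsPn nl] :=
      boolP [exists l, (l != k) && (h l == a)].
    rewrite (_ : \det (rows_of u h) = 0) ?normr0 ?big1//.
    apply: (determinant_alternate lk) => i.
    by rewrite !mxE (eqP hk) (eqP hl).
  rewrite (big_pred1 k)// => l; apply/idP/idP => [hl|/eqP ->//].
  by have := nl l; rewrite hl andbT negbK.
have minor (k : 'I_n.+1) :
    \sum_(h : {ffun 'I_n.+1 -> J} | h k == a) `|\det (rows_of u h)| = det_sum w.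
  pose ins (g : {ffun 'I_n -> J}) : {ffun 'I_n.+1 -> J} :=
    [ffun i => if unlift k i is Some j then g j else a].
  rewrite (reindex ins)/=; last first.
    exists (fun h => [ffun j => h (lift k j)]) => [g _|h /eqP hk].
      by apply/ffunP => j; rewrite !ffunE liftK.
    apply/ffunP => i; rewrite ffunE; case: unliftP => [j|] ->//.
    by rewrite ffunE.
  apply: eq_big => [g|g _]; first by rewrite ffunE unlift_none eqxx.
  rewrite (expand_det_row _ k) (bigD1 ord0)//= big1 ?addr0 => [|i]; last first.
    case: (unliftP ord0 i) => [j|] ->; last by rewrite eqxx.
    by move=> _; rewrite mxE ffunE unlift_none ua cV_consS mxE mul0r.
  rewrite mxE ffunE unlift_none ua cV_cons0 mul1r /cofactor normrM normrX normrN1.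
  rewrite expr1n mul1r; congr (`|\det _|); apply/matrixP => i j.
  by rewrite !mxE ffunE liftK.
rewrite /det_sum (eq_bigr _ (fun h _ => hit h)) big_split/=; congr (_ + _).
rewrite (exchange_big_dep xpredT)//= (eq_bigr (fun=> det_sum w)); last first.
  by move=> k _; rewrite -(minor k).
by rewrite sumr_const card_ord mulr_natl.
Qed.

(** Both sides obey the same recursion once a nonzero generator is moved to the first basis vector.
    It lowers either the dimension or the number of nonzero generators, hence the nested
    inductions. *)
Theorem volume_zonotope (J : finType) n (v : J -> 'cV[R]_n) :
  volume (zonotope v) = (2 ^+ n / n`!%:R * det_sum v)%:E.
Proof.
elim: n J v => [|n IHn] J v.
  rewrite /volume (_ : _ @^-1` _ = setT); last first.
    apply/seteqP; split=> // t _ /=; exists (fun=> 0) => [j|].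
      by rewrite normr0.
    by apply/colP => -[].
  rewrite /= diracT /det_sum (eq_bigr (fun=> 1)) => [|h _]; last first.
    by rewrite det_mx00 normr1.
  rewrite sumr_const card_ffun card_ord expn0 expr0 fact0 divr1 mul1r.
  by [].
have [m vm] := ubnP #|[pred j | v j != 0]|.
elim: m v vm => // m IHm v vm.
have [a va|v0'] := pickP [pred j | v j != 0]; last first.
  have v0 j : v j = 0 by have /= /negbFE/eqP := v0' j.
  rewrite /det_sum big1 => [|h _]; last first.
    rewrite (expand_det_row _ ord0) big1 ?normr0// => i _.
    by rewrite mxE v0 mxE mul0r.
  (* Only the origin is left: a box with a null side, since the dimension is positive. *)
  rewrite mulr0 /volume (_ : _ @^-1` _ = [set t | forall i, [set 0] (tnth t i)]).
    have := @tuple_measure_box _ (measurableTypeR R) R (@lebesgue_measure R) n.+1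
      (fun=> [set 0]) (fun=> measurable_set1 _).
    by rewrite big_ord_recl [X in (X * _)%E](lebesgue_measure_set1 0) mul0e.
  apply/seteqP; split=> [t [s _ st] i|t t0].
    have := congr1 (fun z : 'cV[R]_n.+1 => z i 0) st.
    rewrite mxE => /= ->.
    by rewrite summxE big1// => j _; rewrite v0 scaler0 mxE.
  exists (fun=> 0) => [j|]; first by rewrite normr0.
  apply/colP => i; rewrite !mxE (t0 i) summxE big1// => j _.
  by rewrite scale0r mxE.
move: va => /= va.
have [N Nu Na] := exists_unitmx_to_basis va.
have N0 : 0 < `|\det N| by rewrite normr_gt0 -unitfE -unitmxE.
pose u j := N *m v j.
have : volume (zonotope u) = (2 ^+ n.+1 / n.+1`!%:R * det_sum u)%:E.
  rewrite (volume_thicken_zonotope Na) (det_sum_split Na) IHn.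
  rewrite (_ : zonotope _ =
    [set N *m x | x in zonotope (fun j => if j == a then 0 else v j)]); last first.
    rewrite zonotope_mulmx; congr zonotope; apply/funext => j; rewrite /u.
    by case: eqP => //; rewrite mulmx0.
  rewrite volume_image_unitmx//; last exact: cV_measurable_zonotope.
  rewrite IHm; last first.
    rewrite -ltnS; apply: leq_trans vm; rewrite ltnS.
    apply: proper_card; apply/properP; split.
      apply/fintype.subsetP => j; rewrite !inE.
      by case: (j == a); rewrite ?eqxx.
    by exists a; rewrite !inE ?eqxx.
  rewrite -EFinM -EFinM -EFinD; congr EFin.
  rewrite (_ : det_sum (fun j => if j == a then 0 else u j) =
    `|\det N| * det_sum (fun j => if j == a then 0 else v j)); last first.
    rewrite -det_sum_mulmx; congr det_sum; apply/funext => j; rewrite /u.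
    by case: eqP => //; rewrite mulmx0.
  rewrite factS natrM exprS; field.
  by rewrite addrC natr1 !pnatr_eq0 -lt0n fact_gt0.
rewrite -(zonotope_mulmx N v) volume_image_unitmx//; last exact: cV_measurable_zonotope.
rewrite det_sum_mulmx mulrCA EFinM => /(congr1 (fun y => (`|\det N|^-1)%:E * y)%E).
by rewrite !muleA -!EFinM mulVf ?gt_eqF// !mul1e mul1r.
Qed.

End volume_of_zonotopes.

(** * Gaussian moments and their discretization *)

Section gaussian_moments.
Context {R : realType}.
Local Notation mu := (@lebesgue_measure R).

(** Left unnormalized, as in the integrand of the statement; the powers of sqrt(2 pi) are collected
    in [ball_const]. *)
Definition gauss (x : R) : R := expR (- 2^-1 * x ^+ 2).

Lemma gauss_ge0 x : 0 <= gauss x. Proof. exact: expR_ge0. Qed.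

Lemma gaussN x : gauss (- x) = gauss x.
Proof. by rewrite /gauss sqrrN. Qed.

Lemma continuous_gauss : continuous gauss.
Proof.
move=> x; apply: (@continuous_comp _ _ _ (fun x : R => - 2^-1 * x ^+ 2) expR).
  by apply: cvgM; [exact: cvg_cst|exact: exprn_continuous].
exact: continuous_expR.
Qed.

Lemma measurable_gauss : measurable_fun [set: measurableTypeR R] gauss.
Proof. exact: (continuous_measurable_fun continuous_gauss). Qed.

Lemma integral_gauss : (\int[mu]_x (gauss x)%:E)%E = (Num.sqrt (2 * pi))%:E.
Proof.
have s2 : 0 < Num.sqrt 2 :> R by rewrite sqrtr_gt0.
have mg : measurable_fun [set: measurableTypeR R] (EFin \o @gauss_fun R).
  by apply/measurable_EFinP; exact: measurable_gauss_fun.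
(* [gauss_fun] is exp(-x^2), of integral sqrt(pi); a dilation by 1/sqrt(2) turns it into [gauss]. *)
have := ge0_integral_affine 0 (invr_neq0 (lt0r_neq0 s2)) mg
  (fun x => gauss_fun_ge0 x).
rewrite /= integralT_gauss gtr0_norm ?invr_gt0//.
rewrite (_ : (\int[mu]_x _)%E = (\int[mu]_x (gauss x)%:E)%E); last first.
  apply: eq_integral => x _; rewrite /gauss_fun /gauss addr0 exprMn exprVn.
  by rewrite sqr_sqrtr// mulNr.
move=> /(congr1 (fun y => (Num.sqrt 2)%:E * y)%E).
by rewrite muleA -EFinM divff ?gt_eqF// mul1e -EFinM -sqrtrM.
Qed.

(** By symmetry this is twice the integral over the half-line, where [- gauss x] is a primitive of
    [x * gauss x]. *)
Lemma integral_norm_gauss : (\int[mu]_x (`|x| * gauss x)%:E)%E = 2%:E.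
Proof.
have dG (x : R) : is_derive x 1 (fun x => - gauss x) (x * gauss x).
  have dq : is_derive x 1 (fun x : R => - 2^-1 * x ^+ 2) (- x).
    have := is_deriveZ (- 2^-1) (is_deriveX 2 (is_derive_id x (1 : R))).
    rewrite (_ : _ \*: _ = fun x : R => - 2^-1 * x ^+ 2).
      by move=> dq; apply: (is_derive_eq dq); rewrite /GRing.scale/= expr1; lra.
    by apply/funext => y; rewrite /GRing.scale/= exprfctE.
  have dG := is_deriveN (@is_derive1_comp _ expR (fun x => - 2^-1 * x ^+ 2)
    _ _ _ (is_derive_expR _) dq).
  rewrite /gauss; apply: (is_derive_eq dG).
  by rewrite mulrN opprK mulrC.
rewrite ge0_symfun_integralT//=.
- rewrite (_ : [set x | _] = `[0, +oo[%classic); last first.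
    by apply/seteqP; split => x/=; rewrite in_itv/= andbT.
  have -> : (\int[mu]_(x in `[0%R, +oo[) (`|x| * gauss x)%:E =
      \int[mu]_(x in `[0%R, +oo[) (x * gauss x)%:E)%E.
    by apply: eq_integral => x; rewrite inE/= in_itv/= andbT => x0; rewrite ger0_norm.
  rewrite (@ge0_continuous_FTC2y _ (fun x => x * gauss x) (fun x => - gauss x) 0 0).
  + by rewrite /gauss expr0n mulr0 expR0 sub0e -EFinN opprK mule1.
  + by move=> x x0; rewrite mulr_ge0 ?gauss_ge0.
  + apply: continuous_subspaceT => x; apply: cvgM; first exact: cvg_id.
    exact: continuous_gauss.
  + rewrite -oppr0; apply: cvgN; rewrite /gauss.
    rewrite (_ : (fun x => _) = (fun x : R => expR (- x)) \o (fun x => 2^-1 * x ^+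
      2)); last first.
      by apply/funext => x /=; rewrite mulNr.
    apply: cvg_comp; last exact: cvgr_expR.
    apply/cvgryPge => A; near=> x.
    have x1 : 1 <= x by near: x; apply: nbhs_pinfty_ge; exact: num_real.
    have xA : 2 * A <= x by near: x; apply: nbhs_pinfty_ge; exact: num_real.
    nra.
  + by move=> x _; have [] := dG x.
  + apply: cvg_at_right_filter; apply: cvgN; exact: (@continuous_gauss 0).
  + by move=> x _; rewrite derive1E; have [_ ->] := dG x.
- by move=> x; rewrite mulr_ge0 ?gauss_ge0.
- move=> x; apply: cvgM; last exact: continuous_gauss.
  exact: norm_continuous.
- by move=> x /=; rewrite normrN gaussN.
Unshelve. all: by end_near. Qed.

End gaussian_moments.

(** * Simple functions of Gaussian coordinates *)

Section gaussian_discretization.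
Context {R : realType}.
Import HBNNSimple.
Local Notation mu := (@lebesgue_measure R).

Definition gauss_prod n (w : 'cV[R]_n) : R := \prod_i gauss (w i 0).

Lemma gauss_prod_ge0 n (w : 'cV[R]_n) : 0 <= gauss_prod w.
Proof. by apply: prodr_ge0 => i _; exact: gauss_ge0. Qed.

Lemma cV_measurable_gauss_prod n : cV_measurable_fun (@gauss_prod n).
Proof.
exact: (@cV_measurable_prod R n (fun=> gauss) (fun=> measurable_gauss)).
Qed.

Lemma integral_1norm_gauss :
  (\int[mu]_x ((1 + `|x|) * gauss x)%:E)%E = (Num.sqrt (2 * pi) + 2)%:E.
Proof.
under eq_integral do rewrite mulrDl mul1r EFinD.
have mg : measurable_fun [set: measurableTypeR R] (fun x : R => (gauss x)%:E).
  by apply/measurable_EFinP; exact: measurable_gauss.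
rewrite ge0_integralD//=.
- by rewrite integral_gauss integral_norm_gauss EFinD.
- by move=> x _; rewrite lee_fin gauss_ge0.
- by move=> x _; rewrite lee_fin mulr_ge0 ?gauss_ge0.
- apply/measurable_EFinP; apply: measurable_funM; last exact: measurable_gauss.
  exact: normr_measurable.
Qed.

(** The dominating weight is a product over the coordinates, so its integral is a power of
    [integral_1norm_gauss]; it covers determinants as well as the discretization error. Applied to a
    constant sequence, the first conclusion is a finiteness criterion. *)
Lemma cV_dominated_cvg n (F : nat -> 'cV[R]_n -> R) (F0 : 'cV[R]_n -> R) (C : R) :
  (forall k, cV_measurable_fun (F k)) -> cV_measurable_fun F0 ->
  (forall k w, 0 <= F k w) ->
  (forall w, F k w @[k --> \oo] --> F0 w) ->
  (forall k w, F k w <= C * \prod_i (1 + `|w i 0|)) -> 0 <= C ->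
  cV_integral (fun w => (F0 w * gauss_prod w)%:E) \is a fin_num /\
  (cV_integral (fun w => (F k w * gauss_prod w)%:E) @[k --> \oo] -->
   cV_integral (fun w => (F0 w * gauss_prod w)%:E)).
Proof.
move=> mF mF0 Fge0 FF0 FC C0.
pose h (w : 'cV[R]_n) := \prod_i ((1 + `|w i 0|) * gauss (w i 0)).
have mh1 : measurable_fun [set: measurableTypeR R] (fun x : R => (1 + `|x|) * gauss x).
  apply: measurable_funM; last exact: measurable_gauss.
  by apply: measurable_funD.
have mh : cV_measurable_fun h.
  by apply: (@cV_measurable_prod R n (fun=> fun x => (1 + `|x|) * gauss x)).
have h0 w : 0 <= h w.
  by apply: prodr_ge0 => i _; rewrite mulr_ge0 ?gauss_ge0// addr_ge0.
have ih : (lebesgue_tuple R n).-integrable setT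
    (fun t => (C * h (cV_of_tuple t))%:E).
  apply/integrableP; split.
    by apply/measurable_EFinP; exact: measurable_funM.
  rewrite (_ : (\int[_]_x _)%E = cV_integral (fun w => C%:E * (h w)%:E)%E); last first.
    by apply: eq_integral => t _; rewrite /= ger0_norm ?EFinM// mulr_ge0.
  rewrite ge0_cV_integralZl//; last exact/measurable_EFinP.
  rewrite (@cV_integral_prod R n (fun=> fun x => (1 + `|x|) * gauss x))//; last first.
    by move=> i x; rewrite mulr_ge0 ?gauss_ge0// addr_ge0.
  rewrite (eq_bigr (fun=> (Num.sqrt (2 * pi) + 2)%:E)) => [|i _]; last first.
    exact: integral_1norm_gauss.
  by rewrite prodEFin -EFinM ltry.
have mg := @cV_measurable_gauss_prod n.
have := @dominated_convergence _ _ R (lebesgue_tuple R n) setT measurableT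
  (fun k t => (F k (cV_of_tuple t) * gauss_prod (cV_of_tuple t))%:E)
  (fun t => (F0 (cV_of_tuple t) * gauss_prod (cV_of_tuple t))%:E)
  (fun t => (C * h (cV_of_tuple t))%:E).
case=> //.
- by move=> k; apply/measurable_EFinP; exact: (measurable_funM (mF k) mg).
- by apply/measurable_EFinP; exact: (measurable_funM mF0 mg).
- apply: aeW => t _; apply: cvg_EFin; first exact: nearW.
  rewrite [X in X @ _ --> _](_ : _ = (fun k => F k (cV_of_tuple t) * gauss_prod
    (cV_of_tuple t)))//.
  by apply: cvgMl; exact: FF0.
- apply: aeW => t k _ /=; rewrite lee_fin ger0_norm; last first.
    by rewrite mulr_ge0 ?gauss_prod_ge0.
  by rewrite /h big_split/= mulrA ler_wpM2r ?gauss_prod_ge0.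
- move=> iF0 _ cF; split; last exact: cF.
  exact: integral_fune_fin_num.
Qed.

(** Positive and negative parts are approximated from below separately; this keeps |s_k x| <= |x|,
    the source of a dominating function independent of [k]. *)
Lemma exists_simple_approximation : exists s : nat -> R -> R,
  [/\ forall k, measurable_fun [set: measurableTypeR R] (s k),
      forall k, finite_set (range (s k)),
      forall k x, `|s k x| <= `|x| &
      forall x, s k x @[k --> \oo] --> x].
Proof.
pose pos (x : R) := (`|x| + x) / 2; pose neg (x : R) := (`|x| - x) / 2.
have pos0 x : 0 <= pos x by have := ler_norm (- x); rewrite normrN /pos; lra.
have neg0 x : 0 <= neg x by have := ler_norm x; rewrite /neg; lra.
have mp : measurable_fun [set: measurableTypeR R] (fun x : R => (pos x)%:E).
  by apply/measurable_EFinP/measurable_funM => //; exact: measurable_funD.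
have mn : measurable_fun [set: measurableTypeR R] (fun x : R => (neg x)%:E).
  by apply/measurable_EFinP/measurable_funM => //; exact: measurable_funB.
pose p := nnsfun_approx measurableT mp; pose m := nnsfun_approx measurableT mn.
have cp x : p k x @[k --> \oo] --> pos x.
  have ge0 (y : R) : setT y -> (0 <= (pos y)%:E)%E by rewrite lee_fin.
  by have /fine_cvg := @cvg_nnsfun_approx _ _ _ setT measurableT _ mp ge0 x I.
have cm x : m k x @[k --> \oo] --> neg x.
  have ge0 (y : R) : setT y -> (0 <= (neg y)%:E)%E by rewrite lee_fin.
  by have /fine_cvg := @cvg_nnsfun_approx _ _ _ setT measurableT _ mn ge0 x I.
have lep k x : 0 <= p k x <= pos x.
  rewrite fun_ge0/= -(cvg_lim _ (cp x))//.
  apply: (@nondecreasing_cvgn_le _ (fun k => p k x)).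
    by move=> i j ij; have /lefP := nd_nnsfun_approx measurableT mp ij; exact.
  by apply/cvg_ex; exists (pos x).
have lem k x : 0 <= m k x <= neg x.
  rewrite fun_ge0/= -(cvg_lim _ (cm x))//.
  apply: (@nondecreasing_cvgn_le _ (fun k => m k x)).
    by move=> i j ij; have /lefP := nd_nnsfun_approx measurableT mn ij; exact.
  by apply/cvg_ex; exists (neg x).
exists (fun k x => p k x - m k x); split => [k|k|k x|x].
- by apply: measurable_funB.
- apply: sub_finite_set (finite_image2 (fun a b => a - b) (fimfunP (p k)) (fimfunP (m
  k))).
  by move=> _ [x _ <-]; exists (p k x) => //; exists (m k x).
- have := lep k x; have := lem k x; rewrite ler_norml /pos /neg.
  have [x0|x0] := lerP 0 x.
    by rewrite ger0_norm// => /andP[? ?] /andP[? ?]; apply/andP; split; lra.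
  by rewrite ltr0_norm// => /andP[? ?] /andP[? ?]; apply/andP; split; lra.
- rewrite [X in _ --> X](_ : x = pos x - neg x); first exact: cvgB.
  by rewrite /pos /neg; lra.
Qed.

(** Labels the line by the finite type of values of [s], so that integrals of functions of [s]
    become finite sums. *)
Lemma exists_levels (s : R -> R) : measurable_fun [set: measurableTypeR R] s ->
  finite_set (range s) -> exists (J : finType) (q : J -> R) (l : R -> J),
  (forall x, s x = q (l x)) /\
  (forall j, measurable (l @^-1` [set j] : set (measurableTypeR R))).
Proof.
move=> ms /finite_seqP[X sX].
have Xs x : s x \in X by have : range s (s x) by []; rewrite sX.
exists (seq_sub X), val, (fun x => SeqSub (Xs x)); split=> // j.
rewrite (_ : _ @^-1` _ = s @^-1` [set val j]).
  by rewrite -[X in measurable X]setTI; exact: ms.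
by apply/seteqP; split=> x /= => [<-//|sxj]; exact: val_inj.
Qed.

Section levels.
Variables (J : finType) (q : J -> R) (l : R -> J) (s : R -> R).
Hypothesis sE : forall x, s x = q (l x).
Hypothesis ml : forall j, measurable (l @^-1` [set j] : set (measurableTypeR R)).

Definition level_mass j : R := fine (\int[mu]_x ((l x == j)%:R * gauss x)%:E)%E.

Let measurable_level j :
  measurable_fun [set: measurableTypeR R] (fun x => (l x == j)%:R * gauss x).
Proof.
apply: measurable_funM; last exact: measurable_gauss.
rewrite (_ : (fun x => _) = \1_(l @^-1` [set j])); first exact: measurable_indic.
apply/funext => x; rewrite indicE; congr (_%:R); congr nat_of_bool.
by apply/eqP/idP => [lj|/set_mem//]; exact: mem_set.
Qed.

Lemma level_massE j :
  (\int[mu]_x ((l x == j)%:R * gauss x)%:E)%E = (level_mass j)%:E.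
Proof.
rewrite fineK// ge0_fin_numE; last first.
  by apply: integral_ge0 => x _; rewrite lee_fin mulr_ge0 ?gauss_ge0.
apply: (@le_lt_trans _ _ (\int[mu]_x (gauss x)%:E)%E); last first.
  by rewrite integral_gauss ltry.
apply: ge0_le_integral => //=.
- by move=> x _; rewrite lee_fin mulr_ge0 ?gauss_ge0.
- by apply/measurable_EFinP; exact: (measurable_level j).
- by apply/measurable_EFinP; exact: measurable_gauss.
- move=> x _; rewrite lee_fin ler_piMl ?gauss_ge0//.
  by case: eqP; rewrite ?ler01.
Qed.

Lemma level_mass_ge0 j : 0 <= level_mass j.
Proof.
rewrite fine_ge0//; apply: integral_ge0 => x _.
by rewrite lee_fin mulr_ge0 ?gauss_ge0.
Qed.

Lemma integral_level_box n (f : {ffun 'I_n -> J}) :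
  cV_integral (fun w => (\prod_i ((l (w i 0) == f i)%:R * gauss (w i 0)))%:E) =
  (\prod_i level_mass (f i))%:E.
Proof.
rewrite (cV_integral_prod (F := fun i x => (l x == f i)%:R * gauss x)) => [||i x].
- by rewrite -prodEFin; apply: eq_bigr => i _; exact: level_massE.
- by move=> i; exact: measurable_level.
- by rewrite mulr_ge0 ?gauss_ge0.
Qed.

(** The level boxes partition the space: only the labelling of [w] itself gives a nonzero term. *)
Lemma level_sum n (G : 'cV[R]_n -> R) (w : 'cV[R]_n) :
  G (map_mx s w) * gauss_prod w = \sum_(f : {ffun 'I_n -> J})
     G (\col_i q (f i)) * \prod_i ((l (w i 0) == f i)%:R * gauss (w i 0)).
Proof.
rewrite (bigD1 [ffun i => l (w i 0)])//= [X in _ + X]big1 ?addr0 => [|f ne].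
  congr (G _ * _); first by apply/colP => i; rewrite !mxE ffunE sE.
  by apply: eq_bigr => i _; rewrite ffunE eqxx mul1r.
have [/forallP fl|/forallPn[i fi]] := boolP [forall i, l (w i 0) == f i].
  case/eqP: ne; apply/ffunP => i; rewrite ffunE; exact/esym/eqP.
by rewrite (bigD1 i)//= (negbTE fi) mul0r mul0r mulr0.
Qed.

Lemma integral_levels n (G : 'cV[R]_n -> R) : (forall w, 0 <= G w) ->
  cV_integral (fun w => (G (map_mx s w) * gauss_prod w)%:E) =
  (\sum_(f : {ffun 'I_n -> J}) G (\col_i q (f i)) * \prod_i level_mass (f i))%:E.
Proof.
move=> G0.
have mf (f : {ffun 'I_n -> J}) : cV_measurable_fun
   (fun w : 'cV[R]_n => \prod_i ((l (w i 0) == f i)%:R * gauss (w i 0))).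
  apply: (@cV_measurable_prod R n (fun i x => (l x == f i)%:R * gauss x)) => i.
  exact: measurable_level.
have f0 (f : {ffun 'I_n -> J}) (w : 'cV[R]_n) :
    0 <= \prod_i ((l (w i 0) == f i)%:R * gauss (w i 0)).
  by apply: prodr_ge0 => i _; rewrite mulr_ge0 ?gauss_ge0.
under cV_integral_ext do rewrite level_sum -sumEFin.
rewrite /cV_integral ge0_integral_sum//; last 2 first.
- move=> f; apply/measurable_EFinP.
  exact: (measurable_funM (measurable_cst (G (\col_i q (f i)))) (mf f)).
- by move=> f t _; rewrite lee_fin mulr_ge0.
rewrite -sumEFin; apply: eq_bigr => f _; rewrite EFinM -integral_level_box.
rewrite -ge0_cV_integralZl//.
- by apply/measurable_EFinP; exact: (mf f).
- by move=> w; rewrite lee_fin.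
Qed.

End levels.

End gaussian_discretization.

(** * Euclidean balls and zonotopes *)

Section euclidean_balls.
Context {R : realType}.

Definition dotv n (x y : 'cV[R]_n) : R := \sum_i x i 0 * y i 0.

Definition unit_ball n : set 'cV[R]_n := [set x | dotv x x <= 1].

Definition nrm n (x : 'cV[R]_n) : R := Num.sqrt (dotv x x).

Lemma dotv_ge0 n (x : 'cV[R]_n) : 0 <= dotv x x.
Proof. by apply: sumr_ge0 => i _; rewrite -expr2 sqr_ge0. Qed.

Lemma nrm_sqr n (x : 'cV[R]_n) : nrm x ^+ 2 = dotv x x.
Proof. by rewrite sqr_sqrtr// dotv_ge0. Qed.

Lemma nrm_ge0 n (x : 'cV[R]_n) : 0 <= nrm x.
Proof. exact: sqrtr_ge0. Qed.

Lemma dotvC n (x y : 'cV[R]_n) : dotv x y = dotv y x.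
Proof. by apply: eq_bigr => i _; rewrite mulrC. Qed.

Lemma dotvDr n (x y z : 'cV[R]_n) : dotv x (y + z) = dotv x y + dotv x z.
Proof. by rewrite -big_split; apply: eq_bigr => i _; rewrite mxE mulrDr. Qed.

Lemma dotvZr n (x y : 'cV[R]_n) a : dotv x (a *: y) = a * dotv x y.
Proof. by rewrite mulr_sumr; apply: eq_bigr => i _; rewrite mxE mulrCA. Qed.

Lemma dotvDl n (x y z : 'cV[R]_n) : dotv (x + y) z = dotv x z + dotv y z.
Proof. by rewrite dotvC dotvDr !(dotvC z). Qed.

Lemma dotvZl n (x y : 'cV[R]_n) a : dotv (a *: x) y = a * dotv x y.
Proof. by rewrite dotvC dotvZr dotvC. Qed.

Lemma dotvBr n (x y z : 'cV[R]_n) : dotv x (y - z) = dotv x y - dotv x z.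
Proof. by rewrite dotvDr -scaleN1r dotvZr mulN1r. Qed.

Lemma dotvBl n (x y z : 'cV[R]_n) : dotv (x - y) z = dotv x z - dotv y z.
Proof. by rewrite dotvDl -scaleN1r dotvZl mulN1r. Qed.

Lemma dotv_sumr n (I : finType) (x : 'cV[R]_n) (t : I -> R) (y : I -> 'cV[R]_n) :
  dotv x (\sum_j t j *: y j) = \sum_j t j * dotv x (y j).
Proof.
rewrite /dotv (eq_bigr (fun i => \sum_j t j * (x i 0 * y j i 0))) => [|i _].
  by rewrite exchange_big; apply: eq_bigr => j _; rewrite mulr_sumr.
by rewrite summxE mulr_sumr; apply: eq_bigr => j _; rewrite mxE mulrCA.
Qed.

Lemma dotvE n (x y : 'cV[R]_n) : dotv x y = (x^T *m y) 0 0.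
Proof. by rewrite mxE; apply: eq_bigr => i _; rewrite mxE. Qed.

Lemma dotv_eq0 n (x : 'cV[R]_n) : dotv x x = 0 -> x = 0.
Proof.
move=> /eqP; rewrite psumr_eq0 => [/allP x0|i _]; last by rewrite -expr2 sqr_ge0.
apply/colP => i; rewrite mxE; have := x0 i (mem_index_enum i).
by rewrite mulf_eq0 orbb => /eqP.
Qed.

Lemma nrm_gt0 n (x : 'cV[R]_n) : x != 0 -> 0 < nrm x.
Proof.
move=> x0; rewrite sqrtr_gt0 lt_neqAle dotv_ge0 andbT eq_sym.
by apply: contra_neq x0; exact: dotv_eq0.
Qed.

(** Cauchy-Schwarz, from the nonnegative square of |y| x - |x| y; zero vectors are set apart to
    allow division by |x| |y|. *)
Lemma dotv_le_nrm n (x y : 'cV[R]_n) : dotv x y <= nrm x * nrm y.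
Proof.
have [->|x0] := eqVneq x 0.
  by rewrite /dotv big1 ?mulr_ge0 ?nrm_ge0// => i _; rewrite mxE mul0r.
have [->|y0] := eqVneq y 0.
  by rewrite /dotv big1 ?mulr_ge0 ?nrm_ge0// => i _; rewrite mxE mulr0.
have := dotv_ge0 (nrm y *: x - nrm x *: y).
rewrite dotvBl !dotvBr !dotvZl !dotvZr (dotvC y x) -!nrm_sqr.
rewrite [X in 0 <= X](_ : _ = 2 * nrm x * nrm y * (nrm x * nrm y - dotv x y)).
  by rewrite pmulr_rge0 ?subr_ge0// !mulr_gt0 ?nrm_gt0.
ring.
Qed.

Lemma coord_le_nrm n (x : 'cV[R]_n) i : `|x i 0| <= nrm x.
Proof.
rewrite -sqrtr_sqr ler_wsqrtr// expr2 /dotv (bigD1 i)//= lerDl.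
by apply: sumr_ge0 => j _; rewrite -expr2 sqr_ge0.
Qed.

Lemma nrm_le_sum n (x : 'cV[R]_n) : nrm x <= \sum_i `|x i 0|.
Proof.
have s0 : 0 <= \sum_i `|x i 0| by exact: sumr_ge0.
rewrite -(ger0_norm s0) -sqrtr_sqr ler_wsqrtr// expr2 mulr_suml.
apply: ler_sum => i _; rewrite -expr2 -real_normK ?num_real// expr2 ler_wpM2l//.
by rewrite (bigD1 i)//= lerDl sumr_ge0.
Qed.

Lemma unit_ballP n (x : 'cV[R]_n) : unit_ball x <-> nrm x <= 1.
Proof.
rewrite /unit_ball/= -nrm_sqr; split=> [|x1]; last by rewrite expr_le1 ?nrm_ge0.
by rewrite expr_le1 ?nrm_ge0.
Qed.

Lemma continuous_dist n (b : 'cV[R]_n) :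
  continuous (fun x : 'cV[R]_n => dotv (b - x) (b - x) : R).
Proof.
move=> x; rewrite /continuous_at /dotv.
have FF : Filter (nbhs x) := @nbhs_filter 'cV[R]_n x.
apply: cvg_big => [|i _]; first exact: add_continuous.
have cb : (b - y) i 0 @[y --> x] --> (b - x) i 0.
  rewrite mxE; under eq_fun do rewrite mxE.
  apply: cvgD; first exact: cvg_cst.
  rewrite mxE; under eq_fun do rewrite mxE.
  by apply: cvgN; exact: coord_continuous.
exact: cvgM.
Qed.

(* The separating vector points from the nearest point of the zonotope to [b]. *)
Lemma zonotope_separation n (J : finType) (v : J -> 'cV[R]_n) b : ~ zonotope v b ->
  exists2 u : 'cV[R]_n, u != 0 & \sum_j `|dotv u (v j)| < dotv u b.
Proof.
move=> vb; have Z0 : zonotope v !=set0.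
  exists 0; exists (fun=> 0) => [j|]; first by rewrite normr0.
  by rewrite big1// => j _; rewrite scale0r.
have [p /set_mem pZ pmin] := compact_EVT_min Z0 (@compact_zonotope _ _ _ v)
  (continuous_subspaceT (@continuous_dist n b)).
have bp : b - p != 0 by apply/eqP => /subr0_eq bp; apply: vb; rewrite bp.
exists (b - p) => //; set u := b - p.
have uu : 0 < dotv u u by rewrite -nrm_sqr exprn_gt0// nrm_gt0.
(* The point of the zonotope farthest in direction [u]. *)
pose z := \sum_j Num.sg (dotv u (v j)) *: v j.
have zZ : zonotope v z.
  by exists (fun j => Num.sg (dotv u (v j))) => // j; rewrite normr_sg lern1 leq_b1.
have uz : dotv u z = \sum_j `|dotv u (v j)|.
  by rewrite dotv_sumr; apply: eq_bigr => j _; rewrite [RHS]normrEsg.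
suff : dotv u z <= dotv u p.
  have -> : b = u + p by rewrite /u subrK.
  by rewrite -uz dotvDr; lra.
rewrite -subr_le0 -dotvBr leNgt; apply/negP => uzp.
have e s : 0 <= s <= 1 -> dotv u u <= dotv (u - s *: (z - p)) (u - s *: (z - p)).
  move=> s01; have := pmin (s *: z + (1 - s) *: p).
  rewrite inE => /(_ (zonotope_convex s01 zZ pZ)); congr (_ <= dotv _ _);
  rewrite scalerBl scale1r scalerBr /u; apply/colP => i; rewrite !mxE; lra.
set w := z - p in uzp e *; clearbody w u.
pose D := dotv w w; have D0 : 0 <= D by exact: dotv_ge0.
(* Moving from [p] towards [z] by a fraction s changes the squared distance to [b] by s^2 D - 2 s
   (u.w), negative for this s; the term u.w in the denominator keeps s <= 1. *)
pose s := dotv u w / (dotv u w + D).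
have den : 0 < dotv u w + D by rewrite ltr_wpDr.
have s0 : 0 < s by rewrite divr_gt0.
have s1 : s <= 1 by rewrite ler_pdivrMr// mul1r lerDl.
have := e s; rewrite (ltW s0) s1 => /(_ isT).
rewrite dotvBl !dotvBr !dotvZl !dotvZr (dotvC w u) -/D.
have sE : s * (dotv u w + D) = dotv u w by rewrite /s divfK// gt_eqF.
nra.
Qed.

Definition cube_augment n (J : finType) (v : J -> 'cV[R]_n) (e : R) (j : J + 'I_n) :
  'cV[R]_n :=
  match j with inl j => v j | inr k => e *: delta_mx k 0 end.

(** A vector [u] separating a point of the ball from the augmented zonotope would make its support
    function smaller than |u|; the cube contributes e times the l1 norm of [u], at least the missing
    e|u|. *)
Lemma ball_sub_zonotope n (J : finType) (v : J -> 'cV[R]_n) e : 0 <= e ->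
  (forall u, (1 - e) * nrm u <= \sum_j `|dotv u (v j)|) ->
  @unit_ball n `<=` zonotope (cube_augment v e).
Proof.
move=> e0 ve b /unit_ballP b1; apply: contrapT => /zonotope_separation[u u0].
apply/negP; rewrite -leNgt big_sumType/=.
have -> : \sum_k `|dotv u (e *: delta_mx k 0)| = e * \sum_k `|u k 0|.
  rewrite mulr_sumr; apply: eq_bigr => k _; rewrite dotvZr normrM ger0_norm//.
  congr (_ * `|_|); rewrite /dotv (bigD1 k)//= big1 => [|i /negbTE ik].
    by rewrite mxE !eqxx mulr1 addr0.
  by rewrite mxE ik mulr0.
apply: (le_trans (dotv_le_nrm u b)).
have h1 := ve u; have h2 := nrm_le_sum u; have h3 := nrm_ge0 u.
have h4 := nrm_ge0 b; have h5 : e * nrm u <= e * \sum_k `|u k 0| by rewrite ler_wpM2l.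
have h6 : nrm u * nrm b <= nrm u by rewrite ler_piMr.
lra.
Qed.

(** The width bound in the direction of the point p itself gives |p|^2 <= (1 + e)|p|. *)
Lemma zonotope_sub_ball n (J : finType) (v : J -> 'cV[R]_n) e : 0 <= e ->
  (forall u, \sum_j `|dotv u (v j)| <= (1 + e) * nrm u) ->
  zonotope v `<=` [set (1 + e) *: x | x in @unit_ball n].
Proof.
move=> e0 ve _ [t t1 ->]; set p := \sum_j _.
have e1 : 0 < 1 + e by lra.
exists ((1 + e)^-1 *: p); last by rewrite scalerA divff ?gt_eqF// scale1r.
have : dotv p p <= (1 + e) * nrm p.
  rewrite {2}/p dotv_sumr; apply: le_trans (ve p); apply: ler_sum => j _.
  by rewrite (le_trans (ler_norm _))// normrM ler_piMl.
rewrite /unit_ball/= dotvZl dotvZr -nrm_sqr => pe.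
have {}pe : nrm p <= 1 + e.
  have [p0|p0] := eqVneq (nrm p) 0; first by rewrite p0 ltW.
  have : 0 < nrm p by rewrite lt_neqAle eq_sym p0 nrm_ge0.
  nra.
rewrite mulrA -expr2 -exprMn expr_le1//; last by rewrite mulr_ge0 ?nrm_ge0// invr_ge0 ltW.
by rewrite ler_pdivrMl// mulr1.
Qed.

End euclidean_balls.

(** * Rotation invariance and the Gaussian mean width *)

Section gaussian_width.
Context {R : realType}.
Local Notation mu := (@lebesgue_measure R).

Lemma gauss_prodE n (w : 'cV[R]_n) : gauss_prod w = expR (- 2^-1 * dotv w w).
Proof.
rewrite /gauss_prod /dotv mulr_sumr expR_sum.
by apply: eq_bigr => i _; rewrite /gauss expr2.
Qed.

Lemma dotv_orthogonal n (H : 'M[R]_n) (x y : 'cV[R]_n) : H^T *m H = 1%:M ->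
  dotv (H *m x) (H *m y) = dotv x y.
Proof. by move=> HH; rewrite !dotvE trmx_mul -mulmxA (mulmxA H^T) HH mul1mx. Qed.

(** The Householder reflection in the hyperplane orthogonal to u - e_1. *)
Lemma exists_reflection n (u : 'cV[R]_n.+1) : dotv u u = 1 ->
  exists2 H : 'M[R]_n.+1, H^T *m H = 1%:M & H *m u = cV_cons 1 0.
Proof.
move=> u1; pose e : 'cV[R]_n.+1 := cV_cons 1 0.
have [ue|ue] := eqVneq u e.
  by exists 1%:M; rewrite ?trmx1 ?mul1mx// ue.
pose v := u - e; have v0 : v != 0 by rewrite subr_eq0.
have vv0 : dotv v v != 0 by rewrite -nrm_sqr expf_neq0// gt_eqF// nrm_gt0.
have vv : v^T *m v = (dotv v v)%:M by rewrite [LHS]mx11_scalar dotvE.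
have vu : v^T *m u = (dotv v u)%:M by rewrite [LHS]mx11_scalar dotvE.
have ee : dotv e e = 1.
  rewrite /dotv big_ord_recl cV_cons0 mulr1 big1 ?addr0// => i _.
  by rewrite cV_consS mxE mul0r.
(* As [u] and [e] are unit vectors, subtracting c (v.u) v from [u] subtracts exactly [v]. *)
have vuE : dotv v v = 2 * dotv v u.
  rewrite /v !dotvBl !dotvBr u1 ee (dotvC e u); lra.
pose c := 2 / dotv v v.
exists (1%:M - c *: (v *m v^T)).
  have PT : (1%:M - c *: (v *m v^T))^T = 1%:M - c *: (v *m v^T).
    rewrite [LHS]raddfB/= trmx1; congr (_ - _).
    by rewrite [LHS]linearZ/= trmx_mul trmxK.
  have PP : v *m v^T *m (v *m v^T) = dotv v v *: (v *m v^T).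
    by rewrite -mulmxA (mulmxA v^T) vv mul_scalar_mx scalemxAr.
  rewrite PT mulmxBl mul1mx mulmxBr mulmx1 -scalemxAl -scalemxAr PP !scalerA.
  rewrite (_ : _ * dotv v v = c + c); last by rewrite /c; field.
  by rewrite scalerDl opprB addrK subrK.
rewrite mulmxBl mul1mx -scalemxAl -mulmxA vu mul_mx_scalar scalerA.
rewrite (_ : c * _ = 1) ?scale1r; first by rewrite /v subKr.
rewrite /c {1}vuE; field; move: vv0; rewrite vuE mulf_eq0 negb_or.
by move=> /andP[].
Qed.

Lemma cV_integral_orthogonal n (H : 'M[R]_n) (f : 'cV[R]_n -> R) :
  H^T *m H = 1%:M -> cV_measurable_fun f -> (forall x, 0 <= f x) ->
  cV_integral (fun x => (f (H *m x) * gauss_prod x)%:E) =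
  cV_integral (fun x => (f x * gauss_prod x)%:E).
Proof.
move=> HH mf f0.
have dH : `|\det H| = 1.
  apply/eqP; rewrite -(@pexpr_eq1 _ _ 2)// -normrX expr2 -{1}det_tr -det_mulmx HH.
  by rewrite det1 normr1.
have Hu : H \in unitmx by rewrite unitmxE unitfE -normr_gt0 dH.
have mfg : cV_measurable_fun (fun x => (f x * gauss_prod x)%:E).
  by apply/measurable_EFinP; exact: (measurable_funM mf (@cV_measurable_gauss_prod R n)).
rewrite -(scales_integral_unitmx Hu mfg) => [|x]; last first.
  by rewrite lee_fin mulr_ge0 ?gauss_prod_ge0.
rewrite dH mul1e; apply: cV_integral_ext => x.
by rewrite !gauss_prodE dotv_orthogonal.
Qed.

Lemma cV_measurable_dotv n (u : 'cV[R]_n) :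
  @cV_measurable_fun _ _ (measurableTypeR R) n (dotv u).
Proof.
rewrite /cV_measurable_fun.
rewrite [X in measurable_fun _ X](_ : _ =
  (fun t => \sum_i u i 0 * cV_of_tuple t i 0))//.
apply: measurable_sum => i.
by apply: measurable_funM => //; exact: cV_measurable_fun_coord.
Qed.

(** A rotation takes [u] to a multiple of the first axis, where the integral factors into the
    absolute first moment 2 and [n] Gaussian integrals. *)
Lemma integral_norm_dotv_gauss n (u : 'cV[R]_n.+1) :
  cV_integral (fun w => (`|dotv u w| * gauss_prod w)%:E) =
  (2 * Num.sqrt (2 * pi) ^+ n * nrm u)%:E.
Proof.
have mabs (v : 'cV[R]_n.+1) : cV_measurable_fun (fun w => `|dotv v w|).
  exact: (measurableT_comp (@normr_measurable R setT) (@cV_measurable_dotv _ v)).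
have base : cV_integral (fun w : 'cV[R]_n.+1 => (`|w 0 0| * gauss_prod w)%:E) =
    (2 * Num.sqrt (2 * pi) ^+ n)%:E.
  pose F (i : 'I_n.+1) (x : R) := if i == 0 then `|x| * gauss x else gauss x.
  rewrite (cV_integral_ext (g := fun w => (\prod_i F i (w i 0))%:E)) => [|w].
    rewrite cV_integral_prod.
    - rewrite big_ord_recl /F eqxx integral_norm_gauss.
      rewrite (eq_bigr (fun=> (Num.sqrt (2 * pi))%:E)) => [|i _]; last first.
        exact: integral_gauss.
      by rewrite prodEFin prodr_const card_ord EFinM.
    - move=> i; rewrite /F; case: eqP => _; last exact: measurable_gauss.
      apply: measurable_funM; last exact: measurable_gauss.
      exact: normr_measurable.
    - by move=> i x; rewrite /F; case: eqP; rewrite ?mulr_ge0 ?gauss_ge0.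
  rewrite /gauss_prod !big_ord_recl /F eqxx mulrA; congr (_%:E).
have [->|u0] := eqVneq u 0.
  have d0 (w : 'cV[R]_n.+1) : dotv 0 w = 0 by rewrite /dotv big1// => i _;
    rewrite mxE mul0r.
  rewrite /nrm d0 sqrtr0 mulr0 (cV_integral_ext (g := cst 0%E)) => [|w].
    by rewrite /cV_integral integral0.
  by rewrite d0 normr0 mul0r.
have nu := nrm_gt0 u0; pose v := (nrm u)^-1 *: u.
have v1 : dotv v v = 1.
  by rewrite /v dotvZl dotvZr -nrm_sqr expr2 mulKf ?gt_eqF// mulVf ?gt_eqF.
have uv : u = nrm u *: v by rewrite /v scalerA divff ?gt_eqF// scale1r.
have [H HH Hv] := exists_reflection v1.
rewrite (cV_integral_ext (g := fun w => (nrm u)%:E * (`|dotv v w| * gauss_prod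
  w)%:E)%E); last first.
  by move=> w; rewrite {1}uv dotvZl normrM gtr0_norm// -mulrA EFinM.
rewrite ge0_cV_integralZl ?nrm_ge0//.
- rewrite mulrC EFinM -base; congr (_ * _)%E.
  rewrite -[RHS](cV_integral_orthogonal (f := fun w => `|w 0 0|) HH)//.
    apply: cV_integral_ext => w; rewrite -(dotv_orthogonal v w HH) Hv.
    rewrite /dotv big_ord_recl cV_cons0 mul1r big1 ?addr0// => i _.
    by rewrite cV_consS mxE mul0r.
  exact: (measurableT_comp (@normr_measurable R setT) (@cV_measurable_fun_coord R _ 0)).
- apply/measurable_EFinP.
  exact: (measurable_funM (mabs v) (@cV_measurable_gauss_prod R _)).
- by move=> w; rewrite lee_fin mulr_ge0 ?gauss_prod_ge0.
Qed.

End gaussian_width.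

(** * Minkowski combinations of linear images *)

Section minkowski_combinations.
Context {R : realType}.

(** A Hadamard-type bound with l1 norms: it follows from Laplace expansion, and its sum over all
    selections of rows is a power of one sum ([sum_prod_ffun]). *)
Lemma norm_det_le n (M : 'M[R]_n) : `|\det M| <= \prod_k \sum_i `|M k i|.
Proof.
elim: n M => [|n IHn] M; first by rewrite det_mx00 big_ord0 normr1.
rewrite (expand_det_row _ ord0) (le_trans (ler_norm_sum _ _ _))//.
rewrite [leRHS]big_ord_recl mulr_suml; apply: ler_sum => j _.
rewrite /cofactor !normrM normrX normrN1 expr1n mul1r ler_wpM2l//.
apply: le_trans (IHn _) _; apply: ler_prod => k _; rewrite sumr_ge0//=.
rewrite [leRHS](bigD1_ord j)//= ler_wpDl//.
by apply: ler_sum => i _; rewrite !mxE.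
Qed.

Definition norm1 n (x : 'cV[R]_n) : R := \sum_i `|x i 0|.

Lemma norm1_ge0 n (x : 'cV[R]_n) : 0 <= norm1 x.
Proof. exact: sumr_ge0. Qed.

Lemma norm1Z n a (x : 'cV[R]_n) : norm1 (a *: x) = `|a| * norm1 x.
Proof. by rewrite mulr_sumr; apply: eq_bigr => i _; rewrite mxE normrM. Qed.

Definition mx_norm1 m n (M : 'M[R]_(m, n)) : R := \sum_i \sum_j `|M i j|.

Lemma mx_norm1_ge0 m n (M : 'M[R]_(m, n)) : 0 <= mx_norm1 M.
Proof. by apply: sumr_ge0 => i _; exact: sumr_ge0. Qed.

Lemma norm1_mulmx m n (M : 'M[R]_(m, n)) x : norm1 (M *m x) <= mx_norm1 M * norm1 x.
Proof.
rewrite mulr_suml; apply: ler_sum => i _; rewrite mxE (le_trans (ler_norm_sum _ _ _))//.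
rewrite mulr_suml; apply: ler_sum => j _; rewrite normrM ler_wpM2l//.
by rewrite /norm1 (bigD1 j)//= lerDl sumr_ge0.
Qed.

Lemma sum_prod_ffun (J : finType) n (F : J -> R) :
  \sum_(h : {ffun 'I_n -> J}) \prod_k F (h k) = (\sum_j F j) ^+ n.
Proof.
rewrite -(bigA_distr_bigA (fun=> F)) prodr_const card_ord.
by [].
Qed.

(** Only selections meeting an erased generator lose their determinant. Each loss is at most a
    product of l1 norms, and these products add up to the difference of n-th powers. *)
Lemma det_sum_perturb (J : finType) n (v w : J -> 'cV[R]_n) :
  (forall j, w j = v j \/ w j = 0) ->
  det_sum v <= det_sum w +
    ((\sum_j norm1 (v j)) ^+ n - (\sum_j norm1 (w j)) ^+ n).
Proof.
move=> wv; rewrite -!sum_prod_ffun -subr_ge0 /det_sum -!sumrB -big_split/= -sumrB.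
apply: sumr_ge0 => h _.
have bound (u : J -> 'cV[R]_n) : `|\det (rows_of u h)| <= \prod_k norm1 (u (h k)).
  apply: le_trans (norm_det_le _) _; apply: ler_prod => k _.
  by rewrite sumr_ge0//=; apply: ler_sum => i _; rewrite mxE.
have [/forallP vw|/forallPn[k wk]] := boolP [forall k, w (h k) == v (h k)].
  rewrite (_ : rows_of w h = rows_of v h); last first.
    by apply/matrixP => k i; rewrite !mxE (eqP (vw k)).
  have -> : \prod_k norm1 (w (h k)) = \prod_k norm1 (v (h k)).
    by apply: eq_bigr => k _; rewrite (eqP (vw k)).
  by rewrite subrr addr0 subrr.
have w0 : w (h k) = 0 by have [wE|//] := wv (h k); rewrite wE eqxx in wk.
rewrite [X in X + _ - _](_ : _ = 0); last first.
  apply/eqP; rewrite normr_eq0; apply/eqP; rewrite (expand_det_row _ k) big1// => i _.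
  by rewrite mxE w0 mxE mul0r.
rewrite [X in _ + (_ - X) - _](_ : _ = 0) ?subr0 ?add0r ?subr_ge0//.
rewrite (bigD1 k)//= w0 /norm1 [X in X * _]big1 ?mul0r// => i _.
by rewrite mxE normr0.
Qed.

(** The increment of a power grows with its base point, so a norm sum that depends on the
    discretization can be replaced by a uniform bound. *)
Lemma exprD_sub_homo n (t t' e : R) : 0 <= t -> t <= t' -> 0 <= e ->
  (t + e) ^+ n - t ^+ n <= (t' + e) ^+ n - t' ^+ n.
Proof.
move=> t0 tt' e0; elim: n => [|n IHn]; first by rewrite !expr0.
have E s : (s + e) ^+ n.+1 - s ^+ n.+1 =
    e * (s + e) ^+ n + s * ((s + e) ^+ n - s ^+ n) by rewrite !exprS; ring.
have p0 : 0 <= (t + e) ^+ n - t ^+ n by rewrite subr_ge0 lerXn2r ?nnegrE ?addr_ge0//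
  lerDl.
have t'0 := le_trans t0 tt'.
rewrite !E lerD//.
  by rewrite ler_wpM2l// lerXn2r ?nnegrE ?addr_ge0// lerD2r.
by apply: ler_pM.
Qed.

Variables (n : nat) (L : 'I_n -> 'M[R]_n) (lam : 'I_n -> R).

Definition mink (A : set 'cV[R]_n) : set 'cV[R]_n :=
  minkowski_comb (fun i => [set L i *m x | x in A]) lam.

Lemma minkP A x : mink A x <->
  exists2 y : 'I_n -> 'cV[R]_n, (forall i, A (y i)) & x = \sum_i lam i *: (L i *m y i).
Proof.
split=> [[y [yA ->]]|[y yA ->]].
  have /choice[z zA] : forall i, exists z, A z /\ L i *m z = y i.
    by move=> i; have [z Az zE] := yA i; exists z.
  exists z => [i|]; first by have [] := zA i.
  by apply: eq_bigr => i _; have [_ ->] := zA i.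
exists (fun i => L i *m y i); split=> // i.
by exists (y i).
Qed.

Lemma mink_subset A B : A `<=` B -> mink A `<=` mink B.
Proof. by move=> AB x /minkP[y Ay ->]; apply/minkP; exists y => // i; exact: AB. Qed.

Lemma mink_scale r A : mink [set r *: x | x in A] `<=` [set r *: x | x in mink A].
Proof.
move=> x /minkP[y Ay ->].
have /choice[z zA] : forall i, exists z, A z /\ r *: z = y i.
  by move=> i; have [z Az zE] := Ay i; exists z.
exists (\sum_i lam i *: (L i *m z i)).
  by apply/minkP; exists z => // i; have [] := zA i.
rewrite scaler_sumr; apply: eq_bigr => i _; have [_ <-] := zA i.
by rewrite -scalemxAr !scalerA mulrC.
Qed.

Definition mink_gen (A : finType) (z : A -> 'cV[R]_n) (p : 'I_n * A) : 'cV[R]_n :=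
  lam p.1 *: (L p.1 *m z p.2).

Lemma mink_zonotope (A : finType) (z : A -> 'cV[R]_n) :
  mink (zonotope z) = zonotope (mink_gen z).
Proof.
have E (t : 'I_n -> A -> R) : \sum_i lam i *: (L i *m (\sum_a t i a *: z a)) =
    \sum_p t p.1 p.2 *: mink_gen z p.
  rewrite -(pair_bigA _ (fun i a => t i a *: mink_gen z (i, a)))/=.
  apply: eq_bigr => i _; rewrite mulmx_sumr scaler_sumr; apply: eq_bigr => a _.
  by rewrite /mink_gen/= -scalemxAr !scalerA mulrC.
apply/seteqP; split=> x.
  move=> /minkP[y yz ->].
  have /choice[t tE] : forall i, exists t : A -> R,
      (forall a, `|t a| <= 1) /\ y i = \sum_a t a *: z a.
    by move=> i; have [t t1 tE] := yz i; exists t.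
  exists (fun p => t p.1 p.2) => [p|]; first by have [] := tE p.1.
  by rewrite -E; apply: eq_bigr => i _; have [_ <-] := tE i.
move=> [t t1 ->]; apply/minkP; exists (fun i => \sum_a t (i, a) *: z a).
  by move=> i; exists (fun a => t (i, a)).
rewrite (E (fun i a => t (i, a))); apply: eq_bigr => -[i a] _.
by [].
Qed.

Lemma cV_measurable_mink_zonotope (A : finType) (z : A -> 'cV[R]_n) :
  cV_measurable (mink (zonotope z)).
Proof. by rewrite mink_zonotope; exact: cV_measurable_zonotope. Qed.

Lemma volume_mink_zonotope (A : finType) (z : A -> 'cV[R]_n) :
  volume (mink (zonotope z)) = (2 ^+ n / n`!%:R * det_sum (mink_gen z))%:E.
Proof. by rewrite mink_zonotope volume_zonotope. Qed.

(** Writes the zonotope over the index type of the augmented one, so that [det_sum_perturb] can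
    compare the two. *)
Lemma zonotope_cube_augment0 (A : finType) (z : A -> 'cV[R]_n) :
  zonotope (cube_augment z 0) = zonotope z.
Proof.
apply/seteqP; split=> x [t t1 ->].
  exists (t \o inl) => [a|]; first exact: t1.
  rewrite big_sumType/= [X in _ + X]big1 ?addr0// => k _.
  by rewrite scale0r scaler0.
exists (fun a => if a is inl a then t a else 0) => [[a|k]//|].
  by rewrite normr0.
by rewrite big_sumType/= [X in _ + X]big1 ?addr0// => k _; rewrite scale0r.
Qed.

(** The set is the image of a product of balls in R^(n*n) under a single linear map; compactness is
    what makes it measurable. *)
Lemma mink_ball_compact : compact (mink (@unit_ball R n)).
Proof.
pose unidx (x : 'I_(n * n)) := enum_val (cast_ord (esym (mxvec_cast n n)) x).
have unidxK i j : unidx (mxvec_index i j) = (i, j) by rewrite /unidx cast_ordK enum_rankK.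
pose M : 'M[R]_(n, n * n) := \matrix_(r, x) (lam (unidx x).1 * L (unidx x).1 r (unidx
  x).2).
pose y (v : 'rV[R]_(n * n)) i : 'cV[R]_n := \col_j v 0 (mxvec_index i j).
have My v : M *m v^T = \sum_i lam i *: (L i *m y v i).
  apply/colP => r; rewrite mxE summxE.
  rewrite (reindex _ (curry_mxvec_bij n n)).
  transitivity (\sum_i \sum_j M r (mxvec_index i j) * v^T (mxvec_index i j) 0).
    by rewrite pair_bigA; apply: eq_big => [[]|[]].
  apply: eq_bigr => i _; rewrite mxE [in RHS]mxE mulr_sumr; apply: eq_bigr => j _.
  by rewrite !mxE unidxK/= mulrA.
pose C := [set v : 'rV[R]_(n * n) | forall i, unit_ball (y v i)].
rewrite (_ : mink _ = [set M *m v^T | v in C]); last first.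
  apply/seteqP; split=> [x /minkP[z z1 ->]|x [v Cv <-]]; last first.
    by apply/minkP; exists (y v).
  exists (\row_x z (unidx x).1 (unidx x).2 0).
    move=> i; rewrite (_ : y _ i = z i)//.
    by apply/colP => j; rewrite !mxE unidxK.
  rewrite My; apply: eq_bigr => i _; congr (_ *: (_ *m _)).
  by apply/colP => j; rewrite !mxE unidxK.
apply: compact_linear_image.
have Bc : compact [set v : 'rV[R]_(n * n) | forall i, v ord0 i \in `[-1, 1]].
  have := (@rV_compact R (n * n) (fun=> `[-1, 1]%classic)).
  by apply=> i; exact: segment_compact.
apply: subclosed_compact Bc _ => [|v Cv x]; last first.
  case/mxvec_indexP: x => i j; rewrite in_itv/= -ler_norml.
  have /unit_ballP y1 := Cv i.
  by have := le_trans (coord_le_nrm (y v i) j) y1; rewrite mxE.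
rewrite (_ : C = \bigcap_(i in [set: 'I_n]) ((fun v => dotv (y v i) (y v i)) @^-1`
  [set t | t <= 1])).
  apply: closed_bigI => i _; apply: preimage_closed; last exact: closed_le.
  move=> v _; have FF : Filter (nbhs v) := @nbhs_filter 'rV[R]_(n * n) v.
  apply: cvg_big => [|j _]; first exact: add_continuous.
  have cv : y u i j 0 @[u --> v] --> y v i j 0.
    rewrite mxE; under eq_fun do rewrite mxE.
    exact: coord_continuous.
  exact: cvgM.
apply/seteqP; split=> v /=; first by move=> Cv i _; exact: Cv.
by move=> Cv i; exact: Cv.
Qed.

Lemma cV_measurable_mink_ball : cV_measurable (mink (@unit_ball R n)).
Proof. by apply: compact_cV_measurable; exact: mink_ball_compact. Qed.

End minkowski_combinations.

(** * Zonotopes discretizing the unit ball *)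

Section discrete_approximation.
Context {R : realType}.
Variable n : nat.
Let N := n.+1.

(* The inverse of the integral of [`|w 0 0| * gauss_prod w] over R^(n+1): with it,
   the zonoid of the segments [-c w, c w], c = ball_const * gauss_prod w, is the
   unit ball. *)
Definition ball_const : R := (2 * Num.sqrt (2 * pi) ^+ n)^-1.

Lemma ball_const_gt0 : 0 < ball_const.
Proof.
by rewrite invr_gt0 mulr_gt0// exprn_gt0// sqrtr_gt0 mulr_gt0 ?pi_gt0.
Qed.

Lemma det_scale_rows m (a : 'I_m -> R) (M : 'M[R]_m) :
  \det (\matrix_(k, i) (a k * M k i)) = (\prod_k a k) * \det M.
Proof.
rewrite (_ : \matrix_(k, i) _ = diag_mx (\row_k a k) *m M).
  by rewrite det_mulmx det_diag; congr (_ * _); apply: eq_bigr => k _; rewrite mxE.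
by apply/matrixP => k i; rewrite mul_diag_mx !mxE.
Qed.

(** The k-th row is L_(f k) W_k, where W_k is the k-th block of [w], seen as N vectors of R^N. *)
Definition abs_det (L : 'I_N -> 'M[R]_N) (f : {ffun 'I_N -> 'I_N}) (w : 'cV[R]_(N *
  N)) : R :=
  `|\det (\matrix_(k, i) \sum_j L (f k) i j * w (mxvec_index k j) 0)|.

Section levels.
Variables (J : finType) (q : J -> R) (l : R -> J) (s : R -> R).
Hypothesis sE : forall x, s x = q (l x).
Hypothesis ml : forall j, measurable (l @^-1` [set j] : set (measurableTypeR R)).
Hypothesis ms : measurable_fun [set: measurableTypeR R] s.

(** One segment per cell: the cell's value of the simple function, weighted by its Gaussian mass. *)
Definition level_vector (a : {ffun 'I_N -> J}) : 'cV[R]_N :=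
  (ball_const * \prod_i level_mass l (a i)) *: \col_i q (a i).

(** The left side is the support function of the zonotope, recognized as the mean width of the
    discretized Gaussian. *)
Lemma width_level_vector (u : 'cV[R]_N) :
  (\sum_a `|dotv u (level_vector a)|)%:E =
  (ball_const%:E *
   cV_integral (fun w => (`|dotv u (map_mx s w)| * gauss_prod w)%:E))%E.
Proof.
rewrite (integral_levels sE ml (fun w => normr_ge0 (dotv u w))) -EFinM mulr_sumr.
congr EFin; apply: eq_bigr => a _; rewrite dotvZr normrM ger0_norm; last first.
  by rewrite mulr_ge0 ?(ltW ball_const_gt0)// prodr_ge0// => i _; exact: level_mass_ge0.
by rewrite -mulrA; congr (_ * _); rewrite mulrC.
Qed.

Lemma cV_measurable_map_mx d (T : measurableType d) m (f : 'cV[R]_m -> T) :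
  cV_measurable_fun f -> cV_measurable_fun (fun w => f (map_mx s w)).
Proof.
move=> mf; apply: (@cV_measurable_fun_comp _ _ _ _ _ f (map_mx s)) => // i.
rewrite /cV_measurable_fun [X in measurable_fun _ X](_ : _ =
    s \o (fun t => cV_of_tuple t i 0)); last by apply/funext => t /=; rewrite !mxE.
by apply: (measurableT_comp ms); exact: cV_measurable_fun_coord.
Qed.

Definition l1_error (w : 'cV[R]_N) : R := \sum_i `|s (w i 0) - w i 0|.

Lemma l1_error_ge0 w : 0 <= l1_error w. Proof. exact: sumr_ge0. Qed.

Lemma cV_measurable_l1_error : cV_measurable_fun l1_error.
Proof.
rewrite /cV_measurable_fun [X in measurable_fun _ X](_ : _ = (fun t =>
  \sum_i `|s (cV_of_tuple t i 0) - cV_of_tuple t i 0|))//.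
apply: measurable_sum => i; apply: measurableT_comp => //.
have mc := @cV_measurable_fun_coord R _ i.
apply: measurable_funB (mc).
exact: (measurableT_comp ms mc).
Qed.

Lemma dotv_map_mx_sub (u w : 'cV[R]_N) :
  `|dotv u (map_mx s w) - dotv u w| <= nrm u * l1_error w.
Proof.
rewrite -dotvBr (le_trans (ler_norm_sum _ _ _))// mulr_sumr.
by apply: ler_sum => i _; rewrite normrM !mxE ler_wpM2r// coord_le_nrm.
Qed.

Variable e : R.
Hypothesis eE : (ball_const%:E *
  cV_integral (fun w => (l1_error w * gauss_prod w)%:E))%E = e%:E.

Let mabs_dotv (u : 'cV[R]_N) : cV_measurable_fun (fun w => `|dotv u w|).
Proof. exact: (measurableT_comp (@normr_measurable R setT) (cV_measurable_dotv u)). Qed.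

Let mgauss f : @cV_measurable_fun R _ (measurableTypeR R) N f ->
  cV_measurable_fun (fun w => (f w * gauss_prod w)%:E).
Proof.
by move=> mf; apply/measurable_EFinP; exact: (measurable_funM mf
  (@cV_measurable_gauss_prod R N)).
Qed.

(** Replacing w by s(w) alters u.w by at most |u| times [l1_error], hence the integrated width by at
    most e|u|. Abstract [f] and [g] serve both directions. *)
Let transfer (u : 'cV[R]_N) (f g : 'cV[R]_N -> R) :
  cV_measurable_fun f -> cV_measurable_fun g -> (forall w, 0 <= f w) ->
  (forall w, 0 <= g w) ->
  (forall w, f w <= g w + nrm u * l1_error w) ->
  (ball_const%:E * cV_integral (fun w => (f w * gauss_prod w)%:E) <=
   ball_const%:E * cV_integral (fun w => (g w * gauss_prod w)%:E) + (e * nrm u)%:E)%E.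
Proof.
move=> mf mg f0 g0 fg.
have c0 := ltW ball_const_gt0; have gp0 := @gauss_prod_ge0 R N.
have ml1 := mgauss cV_measurable_l1_error.
have ul0 (w : 'cV[R]_N) : (0 <= (nrm u)%:E * (l1_error w * gauss_prod w)%:E)%E.
  by rewrite -EFinM lee_fin !mulr_ge0 ?nrm_ge0 ?l1_error_ge0.
have -> : (e * nrm u)%:E = (ball_const%:E * cV_integral (fun w : 'cV[R]_N =>
    (nrm u)%:E * (l1_error w * gauss_prod w)%:E))%E.
  rewrite ge0_cV_integralZl ?nrm_ge0//; last first.
    by move=> w; rewrite lee_fin mulr_ge0 ?l1_error_ge0.
  by rewrite muleCA eE -EFinM mulrC.
have mul1 : cV_measurable_fun (fun w : 'cV[R]_N =>
    ((nrm u)%:E * (l1_error w * gauss_prod w)%:E)%E).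
  by apply: emeasurable_funM => //; exact: measurable_cst.
have gg0 (w : 'cV[R]_N) : (0 <= (g w * gauss_prod w)%:E)%E.
  by rewrite lee_fin mulr_ge0.
have ff0 (w : 'cV[R]_N) : (0 <= (f w * gauss_prod w)%:E)%E.
  by rewrite lee_fin mulr_ge0.
have mf' := mgauss mf; have mg' := mgauss mg.
rewrite -ge0_muleDr ?cV_integral_ge0// -ge0_cV_integralD//.
rewrite lee_wpmul2l ?lee_fin//; apply: ge0_le_cV_integral => //.
  exact: (emeasurable_funD mg' mul1).
by move=> w; rewrite -EFinM -EFinD lee_fin mulrA -mulrDl ler_wpM2r.
Qed.

Lemma width_level_vector_le (u : 'cV[R]_N) :
  \sum_a `|dotv u (level_vector a)| <= (1 + e) * nrm u.
Proof.
rewrite -lee_fin width_level_vector.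
have fg w : `|dotv u (map_mx s w)| <= `|dotv u w| + nrm u * l1_error w.
  have := dotv_map_mx_sub u w; have := lerB_dist (dotv u (map_mx s w)) (dotv u w).
  lra.
have := transfer (cV_measurable_map_mx (mabs_dotv u)) (mabs_dotv u)
  (fun w => normr_ge0 _) (fun w => normr_ge0 _) fg.
rewrite integral_norm_dotv_gauss => /le_trans; apply.
rewrite -EFinM -EFinD lee_fin /ball_const mulrA mulVf; first lra.
by rewrite -invr_eq0 gt_eqF// ball_const_gt0.
Qed.

Lemma width_level_vector_ge (u : 'cV[R]_N) :
  (1 - e) * nrm u <= \sum_a `|dotv u (level_vector a)|.
Proof.
suff : nrm u <= \sum_a `|dotv u (level_vector a)| + e * nrm u by lra.
rewrite -lee_fin EFinD width_level_vector.
have fg w : `|dotv u w| <= `|dotv u (map_mx s w)| + nrm u * l1_error w.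
  have := dotv_map_mx_sub u w; rewrite distrC.
  have := lerB_dist (dotv u w) (dotv u (map_mx s w)).
  lra.
have := transfer (mabs_dotv u) (cV_measurable_map_mx (mabs_dotv u))
  (fun w => normr_ge0 _) (fun w => normr_ge0 _) fg.
rewrite integral_norm_dotv_gauss; apply: le_trans.
rewrite -EFinM lee_fin /ball_const mulrA mulVf ?mul1r//.
by rewrite -invr_eq0 gt_eqF// ball_const_gt0.
Qed.

(** Selecting N generators means choosing a body [f k] and a cell of R^N for each row; N cells of
    R^N form one cell of R^(N*N), so the sum over cells is an integral over R^(N*N). Masses and
    [lam] factor out of the rows. *)
Lemma det_sum_level_vector (L : 'I_N -> 'M[R]_N) (lam : 'I_N -> R) :
  (forall i, 0 <= lam i) ->
  (det_sum (mink_gen L lam level_vector))%:E =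
  (\sum_(f : {ffun 'I_N -> 'I_N}) (\prod_k lam (f k) * ball_const ^+ N)%:E *
    cV_integral (fun w => (abs_det L f (map_mx s w) * gauss_prod w)%:E))%E.
Proof.
move=> lam0.
under [in RHS]eq_bigr => f _.
  rewrite (@integral_levels _ _ _ _ _ sE ml _ (abs_det L f) (fun w => normr_ge0 _)).
  rewrite -EFinM; over.
rewrite sumEFin; congr EFin; rewrite /det_sum.
pose join (p : {ffun 'I_N -> 'I_N} * {ffun 'I_N -> {ffun 'I_N -> J}}) :
  {ffun 'I_N -> 'I_N * {ffun 'I_N -> J}} := [ffun k => (p.1 k, p.2 k)].
rewrite (reindex join)/=; last first.
  exists (fun H => ([ffun k => (H k).1], [ffun k => (H k).2])) => [[f h]|H] _ /=.
    by congr (_, _); apply/ffunP => k; rewrite !ffunE.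
  by apply/ffunP => k; rewrite !ffunE; case: (H k).
rewrite -(pair_bigA _ (fun f h => `|\det (rows_of (mink_gen L lam level_vector) (join
  (f, h)))|))/=.
apply: eq_bigr => f _.
(* Cuts a cell of R^(N*N) into its N blocks. *)
pose cur (phi : {ffun 'I_(N * N) -> J}) : {ffun 'I_N -> {ffun 'I_N -> J}} :=
  [ffun k => [ffun j => phi (mxvec_index k j)]].
have cur_bij : bijective cur.
  apply: inj_card_bij; last by rewrite !card_ffun !card_ord expnM.
  move=> phi phi' /ffunP E; apply/ffunP => x; case/mxvec_indexP: x => k j.
  by have := E k; rewrite !ffunE => /ffunP /(_ j); rewrite !ffunE.
rewrite (reindex cur)/=; last exact: onW_bij.
rewrite mulr_sumr; apply: eq_bigr => phi _.
have massE : \prod_x level_mass l (phi x) =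
    \prod_k \prod_j level_mass l (phi (mxvec_index k j)).
  rewrite (reindex _ (curry_mxvec_bij N N)) pair_bigA.
  by apply: eq_big => [[]|[]].
have mass0 : 0 <= \prod_x level_mass l (phi x).
  by apply: prodr_ge0 => x _; exact: level_mass_ge0.
pose M := \matrix_(k < N, i < N) \sum_j L (f k) i j * (\col_x q (phi x)) (mxvec_index
  k j) 0.
rewrite (_ : rows_of _ _ = \matrix_(k, i) ((lam (f k) * (ball_const *
   \prod_j level_mass l (phi (mxvec_index k j)))) * M k i)); last first.
  apply/matrixP => k i; rewrite !mxE !ffunE /= -mulrA; congr (_ * _).
  rewrite mulr_sumr; apply: eq_bigr => j _.
  rewrite !mxE !ffunE mulrCA; congr ((_ * _) * (_ * _)).
  by apply: eq_bigr => i' _; rewrite ffunE.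
rewrite det_scale_rows normrM !big_split/= prodr_const card_ord -massE.
rewrite ger0_norm; last first.
  by rewrite mulr_ge0 ?prodr_ge0// mulr_ge0// exprn_ge0// ltW// ball_const_gt0.
rewrite /abs_det -/M; ring.
Qed.

End levels.
End discrete_approximation.

(** * Two-sided volume bounds with explicit error *)

Section volume_limit.
Context {R : realType}.
Variable n : nat.
Let N := n.+1.

(** Brings linear growth into the product form required by [cV_dominated_cvg]. *)
Lemma sum_le_prod1D m (a : 'I_m -> R) : (forall i, 0 <= a i) ->
  \sum_i a i <= \prod_i (1 + a i).
Proof.
elim: m a => [|m IHm] a a0; first by rewrite !big_ord0 ler01.
rewrite !big_ord_recl; have := IHm (fun i => a (lift ord0 i)) (fun i => a0 _).
have p1 : 1 <= \prod_i (1 + a (lift ord0 i)).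
  rewrite -[leLHS](prodr_const_nat 1 0 0) big_geq//.
  elim/big_ind : _ => // [x y x1 y1|i _]; last by rewrite lerDl.
  by rewrite mulr_ege1.
have := a0 ord0; nra.
Qed.

Lemma abs_det_le (L : 'I_N -> 'M[R]_N) f w :
  abs_det L f w <= (\prod_k mx_norm1 (L (f k))) * \prod_x (1 + `|w x 0|).
Proof.
apply: le_trans (norm_det_le _) _.
rewrite (reindex _ (curry_mxvec_bij N N)).
have -> : \prod_j (1 + `|w (uncurry (@mxvec_index N N) j) 0|) =
    \prod_k \prod_j (1 + `|w (mxvec_index k j) 0|).
  by rewrite pair_bigA; apply: eq_big => [[]|[]].
rewrite -big_split/=; apply: ler_prod => k _; rewrite sumr_ge0//=.
pose y : 'cV[R]_N := \col_j w (mxvec_index k j) 0.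
have -> : \sum_i `|(\matrix_(k, i) \sum_j L (f k) i j * w (mxvec_index k j) 0) k i| =
    norm1 (L (f k) *m y).
  by apply: eq_bigr => i _; rewrite !mxE; congr `|_|; apply: eq_bigr => j _; rewrite mxE.
apply: le_trans (norm1_mulmx _ _) _; rewrite ler_wpM2l ?mx_norm1_ge0//.
apply: le_trans (sum_le_prod1D _) => [|i]; last by [].
by apply: ler_sum => j _; rewrite mxE.
Qed.

Lemma abs_det_ge0 (L : 'I_N -> 'M[R]_N) f w : 0 <= abs_det L f w.
Proof. exact: normr_ge0. Qed.

Lemma cV_measurable_abs_det (L : 'I_N -> 'M[R]_N) f : cV_measurable_fun (abs_det L f).
Proof.
apply: (measurableT_comp (@normr_measurable R setT)).
apply: measurable_sum => s.
apply: measurable_funM => //; apply: measurable_prod => k _.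
rewrite [X in measurable_fun _ X](_ : _ = (fun t => \sum_j L (f k) (s k) j *
   cV_of_tuple t (mxvec_index k j) 0)); last by apply/funext => t; rewrite mxE.
apply: measurable_sum => j; apply: measurable_funM => //.
exact: cV_measurable_fun_coord.
Qed.

Lemma cvg_abs_det (L : 'I_N -> 'M[R]_N) f (s : nat -> R -> R) w :
  (forall x, s k x @[k --> \oo] --> x) ->
  abs_det L f (map_mx (s k) w) @[k --> \oo] --> abs_det L f w.
Proof.
move=> cs; apply: cvg_norm; apply: cvg_big => [|p _]; first exact: add_continuous.
apply: cvgM; first exact: cvg_cst.
apply: cvg_big => [|k _]; first exact: mul_continuous.
rewrite mxE; under eq_fun do rewrite mxE.
apply: cvg_big => [|j _]; first exact: add_continuous.
apply: cvgM; first exact: cvg_cst.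
by under eq_fun do rewrite mxE; exact: cs.
Qed.

Definition gauss_abs_det (L : 'I_N -> 'M[R]_N) (f : {ffun 'I_N -> 'I_N}) : R :=
  fine (cV_integral (fun w => (abs_det L f w * gauss_prod w)%:E)).

(** The factor of the zonotope volume formula times one [ball_const] for each of the N rows. *)
Definition mixed_const : R := 2 ^+ N / N`!%:R * @ball_const R n ^+ N.

(** [t] bounds the total l1 norm of the images of the basis vectors, and [t * (1 + e)] that of the
    level vectors. The gap thus depends on [s] through [e] alone, whatever the number of levels. *)
Lemma volume_sandwich (s : R -> R) (e : R) (L : 'I_N -> 'M[R]_N) (lam : 'I_N -> R)
    (t := (\sum_i lam i * mx_norm1 (L i)) * N%:R) :
  measurable_fun [set: measurableTypeR R] s -> finite_set (range s) ->
  0 <= e ->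
  ((@ball_const R n)%:E * cV_integral (fun w : 'cV[R]_N => (l1_error s w * gauss_prod
    w)%:E))%E = e%:E ->
  (forall i, 0 <= lam i) ->
  exists P : R, [/\ P%:E = (\sum_(f : {ffun 'I_N -> 'I_N})
    (\prod_k lam (f k) * @ball_const R n ^+ N)%:E *
      cV_integral (fun w => (abs_det L f (map_mx s w) * gauss_prod w)%:E))%E,
   ((2 ^+ N / N`!%:R * P)%:E <= ((1 + e) ^+ N)%:E * volume (mink L lam (@unit_ball R
     N)))%E &
   (volume (mink L lam (@unit_ball R N)) <= (2 ^+ N / N`!%:R *
     (P + ((t * (1 + e) + e * t) ^+ N - (t * (1 + e)) ^+ N)))%:E)%E].
Proof.
move=> ms fs e0 eE lam0.
have [J [q [l [sE ml]]]] := exists_levels ms fs.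
pose z := @level_vector R n J q l.
have zle := width_level_vector_le sE ml ms eE.
have zge := width_level_vector_ge sE ml ms eE.
have fact0 : 0 < 2 ^+ N / N`!%:R :> R.
  by rewrite divr_gt0 ?exprn_gt0// ltr0n fact_gt0.
exists (det_sum (mink_gen L lam z)); split.
- exact: det_sum_level_vector.
- rewrite -volume_mink_zonotope -volume_scale; last 2 first.
  + lra.
  + exact: cV_measurable_mink_ball.
  apply: le_volume.
  + exact: cV_measurable_mink_zonotope.
  + by apply: cV_measurable_scale; [lra|exact: cV_measurable_mink_ball].
  + apply: subset_trans (@mink_scale _ _ _ _ (1 + e) _).
    by apply: mink_subset; exact: zonotope_sub_ball.
- apply: (@le_trans _ _ (volume (mink L lam (zonotope (cube_augment z e))))).
    apply: le_volume.
    + exact: cV_measurable_mink_ball.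
    + exact: cV_measurable_mink_zonotope.
    + by apply: mink_subset; exact: ball_sub_zonotope.
  rewrite volume_mink_zonotope lee_fin ler_pM2l//.
  have w0 : det_sum (mink_gen L lam (cube_augment z 0)) = det_sum (mink_gen L lam z).
    have := volume_mink_zonotope L lam (cube_augment z 0).
    rewrite zonotope_cube_augment0 volume_mink_zonotope => -[].
    by move=> /(mulfI (lt0r_neq0 fact0)) ->.
  have := @det_sum_perturb R _ _ (mink_gen L lam (cube_augment z e)) (mink_gen L lam
    (cube_augment z 0)).
  rewrite w0 => /(_ _)/le_trans; apply.
    move=> [i [a|k]]; first by left.
    by right; rewrite /mink_gen/= scale0r mulmx0 scaler0.
  rewrite lerD2l.
  pose T := \sum_i \sum_a norm1 (mink_gen L lam z (i, a)).
  pose T' := \sum_i \sum_k norm1 (lam i *: (L i *m delta_mx k 0)).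
  have sumE x : 0 <= x -> \sum_p norm1 (mink_gen L lam (cube_augment z x) p) = T + x * T'.
    move=> x0; rewrite -(pair_bigA _ (fun i a => norm1 (mink_gen L lam (cube_augment
      z x) (i, a))))/=.
    rewrite /T /T' mulr_sumr -big_split/=; apply: eq_bigr => i _.
    rewrite big_sumType/=; congr (_ + _); rewrite mulr_sumr; apply: eq_bigr => k _.
    by rewrite /mink_gen/= -scalemxAr scalerA mulrC -scalerA norm1Z ger0_norm.
  rewrite !sumE// mul0r addr0.
  have T0 : 0 <= T by apply: sumr_ge0 => i _; apply: sumr_ge0 => a _; exact: norm1_ge0.
  have T'0 : 0 <= T' by apply: sumr_ge0 => i _; apply: sumr_ge0 => a _; exact: norm1_ge0.
  have bound (A : finType) (y : A -> 'cV[R]_N) (Y : R) : \sum_a norm1 (y a) <= Y ->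
      \sum_i \sum_a norm1 (lam i *: (L i *m y a)) <= (\sum_i lam i * mx_norm1 (L i)) * Y.
    move=> yY; rewrite mulr_suml; apply: ler_sum => i _.
    apply: (@le_trans _ _ (lam i * mx_norm1 (L i) * \sum_a norm1 (y a))); last first.
      by rewrite ler_wpM2l// mulr_ge0 ?mx_norm1_ge0.
    rewrite mulr_sumr; apply: ler_sum => a _; rewrite norm1Z ger0_norm//.
    by rewrite -mulrA ler_wpM2l// norm1_mulmx.
  (* The width bound in each coordinate direction limits the sum of the absolute k-th coordinates to
     1 + e; there are N directions. *)
  have Tt : T <= t * (1 + e).
    rewrite /t -mulrA; apply: (bound _ z); rewrite /norm1 exchange_big/=.
    rewrite mulr_natl -[in leRHS](card_ord N) -sumr_const; apply: ler_sum => k _.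
    have := zle (delta_mx k 0).
    have dE x : dotv (delta_mx k 0) x = x k 0.
      rewrite /dotv (bigD1 k)//= big1 ?addr0 => [|i /negbTE ik].
        by rewrite mxE !eqxx mul1r.
      by rewrite mxE ik mul0r.
    rewrite /nrm dE mxE !eqxx sqrtr1 mulr1; apply: le_trans.
    by apply: ler_sum => a _; rewrite dE.
  have T't : T' <= t.
    apply: (bound _ (fun k => delta_mx k 0)).
    rewrite (eq_bigr (fun=> 1)) => [|k _]; first by rewrite sumr_const card_ord.
    rewrite /norm1 (bigD1 k)//= big1 => [|i /negbTE ik].
      by rewrite mxE !eqxx normr1 addr0.
    by rewrite mxE ik normr0.
  have t0 : 0 <= t := le_trans T'0 T't.
  apply: (@le_trans _ _ ((T + e * t) ^+ N - T ^+ N)).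
    rewrite lerD2r; apply: lerXn2r; rewrite ?nnegrE ?(addr_ge0 T0)//.
    - exact: mulr_ge0.
    - exact: mulr_ge0 e0 t0.
    - by rewrite lerD2l ler_wpM2l.
  by apply: exprD_sub_homo => //; exact: mulr_ge0 e0 t0.
Qed.

End volume_limit.

(** * The volume polynomial of linear images of the ball *)

Section volume_of_mink_balls.
Context {R : realType}.
Variable n : nat.
Let N := n.+1.

(** Permuting the blocks of [w] is orthogonal, so it preserves the Gaussian integral, and it
    permutes the rows of the determinant. *)
Lemma gauss_abs_det_perm (L : 'I_N -> 'M[R]_N) (p : {perm 'I_N}) (f : {ffun 'I_N ->
  'I_N}) :
  gauss_abs_det L [ffun k => f (p k)] = gauss_abs_det L f.
Proof.
pose unidx (x : 'I_(N * N)) := enum_val (cast_ord (esym (mxvec_cast N N)) x).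
have unidxK i j : unidx (mxvec_index i j) = (i, j) by rewrite /unidx cast_ordK enum_rankK.
pose g x := mxvec_index ((p^-1)%g (unidx x).1) (unidx x).2.
have g_inj : injective g.
  move=> x y; case/mxvec_indexP: x => i j; case/mxvec_indexP: y => i' j'.
  by move=> /(congr1 unidx); rewrite /g !unidxK/= => -[/perm_inj -> ->].
pose P : 'M[R]_(N * N) := perm_mx (perm g_inj).
have PP : P^T *m P = 1%:M by rewrite /P tr_perm_mx -perm_mxM mulVg perm_mx1.
congr fine; rewrite -[RHS](cV_integral_orthogonal PP); last 2 first.
- exact: cV_measurable_abs_det.
- by move=> w; exact: abs_det_ge0.
apply: cV_integral_ext => w; congr (_ * _)%:E; rewrite /abs_det.
set M := \matrix_(k, i) _; set M' := \matrix_(k, i) _.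
suff -> : M = row_perm p M' by rewrite row_permE det_mulmx det_perm normrM normrX
  normrN1 expr1n mul1r.
apply/matrixP => k i; rewrite !mxE; apply: eq_bigr => j _; rewrite ffunE.
by rewrite /P -row_permE mxE permE /g unidxK/= permK.
Qed.

Theorem volume_mink_ball (L : 'I_N -> 'M[R]_N) (lam : 'I_N -> R) :
  (forall i, 0 <= lam i) ->
  volume (mink L lam (@unit_ball R N)) =
  (\sum_(f : {ffun 'I_N -> 'I_N}) (\prod_k lam (f k)) *
    (@mixed_const R n * gauss_abs_det L f))%:E.
Proof.
move=> lam0; have [s [ms fs s_le s_cvg]] := @exists_simple_approximation R.
have le1 m k (w : 'cV[R]_m) : \prod_i (1 + `|map_mx (s k) w i 0|) <= \prod_i (1 + `|w
  i 0|).
  by apply: ler_prod => i _; rewrite mxE addr_ge0//= lerD2l.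
pose C (f : {ffun 'I_N -> 'I_N}) := \prod_k mx_norm1 (L (f k)).
have C0 f : 0 <= C f by apply: prodr_ge0 => k _; exact: mx_norm1_ge0.
have bd f k w : abs_det L f (map_mx (s k) w) <= C f * \prod_x (1 + `|w x 0|).
  exact: le_trans (abs_det_le _ _ _) (ler_wpM2l (C0 f) (le1 _ _ _)).
have mabs f k : cV_measurable_fun (fun w => abs_det L f (map_mx (s k) w)).
  by apply: (cV_measurable_map_mx (ms k)); exact: cV_measurable_abs_det.
pose I f k := cV_integral (fun w => (abs_det L f (map_mx (s k) w) * gauss_prod w)%:E).
have [Ifin Icvg] : (forall f, cV_integral (fun w => (abs_det L f w * gauss_prod
  w)%:E) \is a fin_num)
    /\ (forall f, I f k @[k --> \oo] --> cV_integral (fun w => (abs_det L f w *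
      gauss_prod w)%:E)).
  have H f := @cV_dominated_cvg R (N * N) (fun k w => abs_det L f (map_mx (s k) w))
    (abs_det L f) (C f) (mabs f) (cV_measurable_abs_det L f) (fun k w => abs_det_ge0
      _ _ _)
    (fun w => @cvg_abs_det R n L f s w s_cvg) (bd f) (C0 f).
  by split=> f; have [] := H f.
(* The constant sequence gives finiteness at each fixed [k]. *)
have Ikfin f k : I f k \is a fin_num.
  have [] := @cV_dominated_cvg R (N * N) (fun _ w => abs_det L f (map_mx (s k) w))
    (fun w => abs_det L f (map_mx (s k) w)) (C f) (fun _ => mabs f k) (mabs f k)
    (fun _ w => abs_det_ge0 _ _ _) (fun w => cvg_cst _) (fun _ => bd f k) (C0 f).
  by [].
have Icvg' f : fine (I f k) @[k --> \oo] --> gauss_abs_det L f.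
  by apply: fine_cvg; rewrite /gauss_abs_det fineK.
have l1_le k (w : 'cV[R]_N) : l1_error (s k) w <= 2 * \prod_i (1 + `|w i 0|).
  apply: (@le_trans _ _ (2 * \sum_i `|w i 0|)); last first.
    by rewrite ler_wpM2l// sum_le_prod1D.
  rewrite mulr_sumr; apply: ler_sum => i _.
  by rewrite (le_trans (ler_normB _ _))// mulr_natl mulr2n lerD2r.
have l1_cvg (w : 'cV[R]_N) : l1_error (s k) w @[k --> \oo] --> (0 : R).
  have -> : 0 = \sum_(i < N) (0 : R) by rewrite big1.
  apply: cvg_big => [|i _]; first exact: add_continuous.
  have -> : 0 = `|w i 0 - w i 0| :> R by rewrite subrr normr0.
  by apply: cvg_norm; apply: cvgB => //; exact: cvg_cst.
pose E k := cV_integral (fun w : 'cV[R]_N => (l1_error (s k) w * gauss_prod w)%:E).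
have Ecvg : E k @[k --> \oo] --> 0%:E.
  have [_] := @cV_dominated_cvg R N (fun k => l1_error (s k)) (fun=> 0) 2
    (fun k => cV_measurable_l1_error (ms k)) (measurable_cst _) (fun k w =>
      l1_error_ge0 _ _)
    l1_cvg l1_le (ler0n R 2).
  rewrite [X in _ --> X -> _](_ : _ = 0%:E)//.
  rewrite (cV_integral_ext (g := cst 0%E)) => [|w]; last by rewrite mul0r.
  by rewrite /cV_integral integral0.
have Efin k : E k \is a fin_num.
  have [] := @cV_dominated_cvg R N (fun _ => l1_error (s k)) (l1_error (s k)) 2
    (fun _ => cV_measurable_l1_error (ms k)) (cV_measurable_l1_error (ms k)) (fun _ w
      => l1_error_ge0 _ _)
    (fun w => cvg_cst _) (fun _ => l1_le k) (ler0n R 2).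
  by [].
have c0 := @ball_const_gt0 R n.
pose e k := @ball_const R n * fine (E k).
have e0 k : 0 <= e k.
  rewrite mulr_ge0 ?(ltW c0)// fine_ge0// cV_integral_ge0// => w.
  by rewrite lee_fin mulr_ge0 ?l1_error_ge0 ?gauss_prod_ge0.
have eE k : ((@ball_const R n)%:E * E k)%E = (e k)%:E by rewrite EFinM fineK.
have e_cvg : e k @[k --> \oo] --> (0 : R).
  rewrite -[X in _ --> X](mulr0 (@ball_const R n)); apply: cvgM; first exact: cvg_cst.
  exact: fine_cvg.
pose P k := \sum_(f : {ffun 'I_N -> 'I_N}) (\prod_k lam (f k) * @ball_const R n ^+ N)
  * fine (I f k).
pose P0 := \sum_(f : {ffun 'I_N -> 'I_N}) (\prod_k lam (f k) * @ball_const R n ^+ N)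
  * gauss_abs_det L f.
have P_cvg : P k @[k --> \oo] --> P0.
  apply: cvg_big => [|f _]; first exact: add_continuous.
  by apply: cvgM => //; exact: cvg_cst.
pose t := (\sum_i lam i * mx_norm1 (L i)) * N%:R.
pose K := mink L lam (@unit_ball R N).
pose r k := (t * (1 + e k) + e k * t) ^+ N - (t * (1 + e k)) ^+ N.
have sand k : ((2 ^+ N / N`!%:R * P k)%:E <= ((1 + e k) ^+ N)%:E * volume K)%E /\
    (volume K <= (2 ^+ N / N`!%:R * (P k + r k))%:E)%E.
  have [Q [QE Q1 Q2]] := volume_sandwich L (ms k) (fs k) (e0 k) (eE k) lam0.
  have -> : P k = Q; last by split.
  apply/esym; apply: EFin_inj; rewrite QE /P -sumEFin; apply: eq_bigr => f _.
  by rewrite [in RHS]EFinM fineK.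
have Kfin : volume K \is a fin_num.
  rewrite ge0_fin_numE ?measure_ge0//.
  by have [_ /le_lt_trans] := sand 0%N; apply; exact: ltry.
rewrite -(fineK Kfin); congr EFin.
have -> : \sum_(f : {ffun 'I_N -> 'I_N}) (\prod_k lam (f k)) *
    (@mixed_const R n * gauss_abs_det L f) = 2 ^+ N / N`!%:R * P0.
  rewrite /P0 mulr_sumr; apply: eq_bigr => f _; rewrite /mixed_const; ring.
have a_cvg : t * (1 + e k) @[k --> \oo] --> t * (1 + 0).
  by apply: cvgM; [exact: cvg_cst|apply: cvgD => //; exact: cvg_cst].
have X_cvg (u : nat -> R) (x : R) : u k @[k --> \oo] --> x -> u k ^+ N @[k --> \oo]
  --> x ^+ N.
  by move=> ux; exact: (cvg_comp u (fun y : R => y ^+ N) ux (@exprn_continuous R N x)).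
(* Each half of the sandwich passes to the limit: the error [r k] tends to 0 and the dilation factor
   to 1. *)
apply/eqP; rewrite eq_le; apply/andP; split.
  have rhs_cvg : 2 ^+ N / N`!%:R * (P k + r k) @[k --> \oo] -->
      2 ^+ N / N`!%:R * (P0 + ((t * (1 + 0) + 0 * t) ^+ N - (t * (1 + 0)) ^+ N)).
    apply: cvgM; first exact: cvg_cst.
    apply: cvgD => //; apply: cvgB; apply: X_cvg => //.
    by apply: cvgD => //; apply: cvgM => //; exact: cvg_cst.
  rewrite mul0r addr0 subrr addr0 in rhs_cvg.
  apply: (ler_cvg_to (cvg_cst (fine (volume K))) rhs_cvg).
  by apply: nearW => k; rewrite -lee_fin fineK//; have [] := sand k.
have lhs_cvg : 2 ^+ N / N`!%:R * P k @[k --> \oo] --> 2 ^+ N / N`!%:R * P0.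
  by apply: cvgM => //; exact: cvg_cst.
have rhs_cvg : (1 + e k) ^+ N * fine (volume K) @[k --> \oo] --> (1 + 0) ^+ N * fine
  (volume K).
  apply: cvgM; last exact: cvg_cst.
  by apply: X_cvg; apply: cvgD => //; exact: cvg_cst.
rewrite addr0 expr1n mul1r in rhs_cvg.
apply: (ler_cvg_to lhs_cvg rhs_cvg).
by apply: nearW => k; rewrite -lee_fin [X in (_ <= X)%E]EFinM fineK//; have [] := sand k.
Qed.

End volume_of_mink_balls.

(** * Uniqueness of the mixed volume coefficients *)

Section mixed_volume_uniqueness.
Context {R : realType}.

(* Inclusion-exclusion over the 0/1 points [b] keeps only the bijections [f]. *)
Lemma sum_alternating_ffun d (f : {ffun 'I_d -> 'I_d}) :
  \sum_(b : {ffun 'I_d -> bool}) (\prod_i (-1) ^+ b i) * \prod_k (b (f k))%:R =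
  (-1) ^+ d * (injectiveb f)%:R :> R.
Proof.
pose m i := #|[pred k | f k == i]|.
transitivity (\prod_i \sum_(b : bool) (-1) ^+ b * b%:R ^+ m i : R).
  rewrite bigA_distr_bigA; apply: eq_bigr => b _; rewrite big_split/=; congr (_ * _).
  rewrite (partition_big f xpredT)//=; apply: eq_bigr => i _.
  rewrite -prodr_const; apply: eq_big => [k|k /eqP -> //].
  by rewrite inE.
(* The term b = 0 is 0 ^+ m i, equal to 1 exactly when [i] is missed by [f]; it then cancels the
   term -1 of b = 1. *)
rewrite (eq_bigr (fun i => - (m i != 0)%:R)) => [|i _]; last first.
  rewrite big_bool/= expr1 expr0 expr1n mul1r expr0n.
  by case: (m i) => [|?] /=; lra.
rewrite prodrN card_ord; congr (_ * _).
have [/injectiveP f_inj|f_ninj] := boolP (injectiveb f).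
  rewrite big1// => i _; suff -> : m i != 0 by [].
  by rewrite -lt0n; apply/card_gt0P; exists (invF f_inj i); rewrite inE f_invF.
have [i mi] : exists i, m i = 0.
  apply: contrapT => nm; move/negP: f_ninj; apply.
  apply/card_uniqP; rewrite size_map -cardE; apply: eq_card => i.
  have : m i != 0 by apply/eqP => mi; apply: nm; exists i.
  rewrite -lt0n => /card_gt0P[k]; rewrite inE => /eqP <-.
  by rewrite map_f ?mem_enum.
by rewrite (bigD1 i)//= mi eqxx mul0r.
Qed.

(** Polarization: the signed sum of volumes at 0/1 points retains the coefficients of bijections
    only, all equal by symmetry to the one at the identity. *)
Lemma mixed_volumeE d (K : 'I_d -> set 'cV[R]_d) c :
  mixed_volume_coefs K c -> mixed_volume K = c [ffun k => k].
Proof.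
move=> cK; apply: xget_unique => [|_ [c' [cK' ->]]]; first by exists c.
pose I := \sum_(f : {ffun 'I_d -> 'I_d}) (-1) ^+ d * (injectiveb f)%:R : R.
have polar a : mixed_volume_coefs K a ->
    I * a [ffun k => k] = \sum_(b : {ffun 'I_d -> bool}) (\prod_i (-1) ^+ b i) *
      fine (volume (minkowski_comb K (fun i => (b i)%:R))).
  move=> [asym aE].
  transitivity (\sum_(f : {ffun 'I_d -> 'I_d}) \sum_(b : {ffun 'I_d -> bool})
      (\prod_i (-1) ^+ b i) * \prod_k (b (f k))%:R * a f).
    rewrite mulr_suml; apply: eq_bigr => f _; rewrite -mulr_suml sum_alternating_ffun.
    have [/injectiveP f_inj|_] := boolP (injectiveb f); last by rewrite mulr0 !mul0r.
    congr (_ * _); rewrite -(asym (perm f_inj)); congr a; apply/ffunP => k.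
    by rewrite !ffunE permE.
  rewrite exchange_big/=; apply: eq_bigr => b _.
  rewrite aE => [|i]; last by rewrite ler0n.
  by rewrite mulr_sumr; apply: eq_bigr => f _; rewrite mulrA.
(* Up to sign, [I] counts the injective maps, among them the identity. *)
have I0 : I != 0.
  rewrite /I -mulr_sumr mulf_neq0 ?signr_eq0// gt_eqF//.
  rewrite (bigD1 [ffun k => k])//= (_ : injectiveb _); last first.
    by apply/injectiveP => x y; rewrite !ffunE.
  by rewrite ltr_pwDl// sumr_ge0.
by apply: (mulfI I0); rewrite !polar.
Qed.

End mixed_volume_uniqueness.

(** * Triangular factorization of positive-definite matrices *)

Section cholesky.
Context {R : realType}.

(** Induction on the size: the Schur complement of the corner entry is again positive definite, and
    its factor becomes the lower right block. *)
Lemma cholesky n (S : 'M[R]_n) : posdefmx S ->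
  exists L : 'M[R]_n, [/\ is_trig_mx L, forall i, 0 < L i i & L *m L^T = S].
Proof.
elim: n S => [|n IHn] S [Ssym Spos].
  exists 0; split; [by apply/is_trig_mxP => -[]|by case|].
  by apply/matrixP => -[].
pose S' : 'M[R]_(1 + n) := S.
pose a : R := S 0 0; pose b := dlsubmx S'; pose D := drsubmx S'.
have Sb : ursubmx S' = b^T by rewrite /b trmx_dlsub /S' Ssym.
have Sa : ulsubmx S' = a%:M.
  rewrite [LHS]mx11_scalar; congr (_%:M); rewrite !mxE /a.
  by congr (S _ _); exact: val_inj.
have SE : S' = block_mx a%:M b^T b D by rewrite -[LHS]submxK Sa Sb.
have DT : D^T = D by rewrite /D trmx_drsub /S' Ssym.
have a0 : 0 < a.
  pose e : 'cV[R]_n.+1 := delta_mx 0 0.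
  have e0 : e != 0 by apply/eqP => /matrixP /(_ 0 0); rewrite !mxE !eqxx => /eqP;
    rewrite oner_eq0.
  have := Spos _ e0; rewrite /quad_form /e trmx_delta -rowE -colE.
  by rewrite !mxE.
have sa : 0 < Num.sqrt a by rewrite sqrtr_gt0.
pose T := D - a^-1 *: (b *m b^T).
have Tpos : posdefmx T.
  split.
    rewrite /T [LHS]raddfB/= DT; congr (_ - _).
    by rewrite [LHS]linearZ/= trmx_mul trmxK.
  (* The upper entry minimizes the quadratic form of [S] for given [y]; the minimum is the form of
     [T] at [y]. *)
  move=> y y0; pose x : 'cV[R]_(1 + n) := col_mx (- a^-1 *: (b^T *m y)) y.
  have x0 : x != 0.
    by apply: contra_neq y0 => /(congr1 dsubmx); rewrite col_mxKd linear0.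
  have Sx : S' *m x = col_mx 0 (T *m y) :> 'cV_(1 + n).
    rewrite SE /x mul_block_col; congr col_mx.
      by rewrite mul_scalar_mx scalerA mulrN divff ?gt_eqF// scaleN1r addNr.
    by rewrite -scalemxAr mulmxBl -scalemxAl mulmxA scaleNr addrC.
  have E : x^T *m (S' *m x) = y^T *m T *m y.
    by rewrite Sx /x tr_col_mx mul_row_col mulmx0 add0r mulmxA.
  have := Spos x x0; rewrite /quad_form -mulmxA => Sx0.
  by rewrite -E.
have [L [Ltrig Ldiag LL]] := IHn _ Tpos.
pose s := Num.sqrt a.
pose B : 'M[R]_(1 + n) := block_mx (s%:M : 'M[R]_1) 0 (s^-1 *: b) L.
have BB : B *m B^T = S'.
  rewrite SE /B tr_block_mx mulmx_block.
  rewrite trmx0 tr_scalar_mx !mulmx0 !mul0mx !addr0.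
  have ss : s * s = a by rewrite -expr2 sqr_sqrtr// ltW.
  congr block_mx.
  + by rewrite -scalar_mxM ss.
  + by rewrite linearZ/= mul_scalar_mx scalerA divff ?gt_eqF// scale1r.
  + by rewrite mul_mx_scalar scalerA divff ?gt_eqF// scale1r.
  + rewrite linearZ/= -scalemxAl -scalemxAr scalerA -invfM ss LL /T.
    by rewrite addrC subrK.
exists B; split => [|i|].
- by rewrite -[is_trig_mx _]/(@is_trig_mx _ (1 + n) (1 + n) _) is_trig_block_mx//
  Ltrig eqxx mx11_is_trig.
- case: (unliftP ord0 i) => [j|] ->.
    rewrite (_ : B _ _ = L j j)//; transitivity (B (rshift 1 j) (rshift 1 j)).
      by congr (B _ _); exact: val_inj.
    by rewrite /B block_mxEdr.
  rewrite (_ : B _ _ = s)//; transitivity (B (lshift n 0) (lshift n 0)).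
    by congr (B _ _); exact: val_inj.
  by rewrite /B block_mxEul mxE eqxx.
- exact: BB.
Qed.

End cholesky.

(** * Substitution of the rows *)

Section row_substitution.
Context {R : realType}.
Variable n : nat.
Let N := n.+1.

Let unidx (x : 'I_(N * N)) := enum_val (cast_ord (esym (mxvec_cast N N)) x).

Let unidxK i j : unidx (mxvec_index i j) = (i, j).
Proof. by rewrite /unidx cast_ordK enum_rankK. Qed.

(** The block-diagonal matrix of the substitution x_k = L_k w_k on R^(N*N), with flattened indices
    decoded by [unidx]. *)
Definition rows_mx (L : 'I_N -> 'M[R]_N) : 'M[R]_(N * N) :=
  \matrix_(x, y) (((unidx x).1 == (unidx y).1)%:R *
    L (unidx x).1 (unidx x).2 (unidx y).2).

Lemma rows_mxE (L : 'I_N -> 'M[R]_N) (w : 'cV[R]_(N * N)) k i :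
  (rows_mx L *m w) (mxvec_index k i) 0 = \sum_j L k i j * w (mxvec_index k j) 0.
Proof.
rewrite mxE (reindex _ (curry_mxvec_bij N N)).
transitivity (\sum_k' \sum_j (k == k')%:R * (L k i j * w (mxvec_index k' j) 0)).
  rewrite pair_bigA; apply: eq_big => [[]|[k' j] _] //=.
  by rewrite !mxE !unidxK/= mulrA.
rewrite (bigD1 k)//= eqxx [X in _ + X]big1 ?addr0 => [|k' kk'].
  by apply: eq_bigr => j _; rewrite mul1r.
by rewrite eq_sym (negbTE kk') big1// => j _; rewrite mul0r.
Qed.

(* Conjugating by the bijection x |-> (x %/ N, x %% N) makes the matrix triangular. *)
Lemma det_rows_mx (L : 'I_N -> 'M[R]_N) : (forall k, is_trig_mx (L k)) ->
  \det (rows_mx L) = \prod_k \det (L k).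
Proof.
move=> Ltrig.
have dlt (x : 'I_(N * N)) : (x %/ N < N)%N by rewrite ltn_divLR.
have mlt (x : 'I_(N * N)) : (x %% N < N)%N by rewrite ltn_mod.
pose g x := mxvec_index (Ordinal (dlt x)) (Ordinal (mlt x)).
have g_inj : injective g.
  move=> x y /(congr1 unidx); rewrite /g !unidxK => -[xy1 xy2].
  by apply: val_inj => /=; rewrite (divn_eq x N) xy1 xy2 -divn_eq.
pose p := perm g_inj.
have -> : \det (rows_mx L) = \det (row_perm p (col_perm p (rows_mx L))).
  rewrite row_permE col_permE !det_mulmx !det_perm odd_permV mulrCA.
  by rewrite -expr2 sqrr_sign mulr1.
rewrite det_trig; last first.
  apply/is_trig_mxP => x y xy; rewrite !mxE !permE /g !unidxK/=.
  case: eqP => [[dxy]|_]; last by rewrite mul0r.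
  have /is_trig_mxP -> := Ltrig (Ordinal (dlt x)); first by rewrite mulr0.
  by move: xy; rewrite /= {1}(divn_eq x N) {1}(divn_eq y N) dxy ltn_add2l.
rewrite (eq_bigr (fun x => L (unidx (p x)).1 (unidx (p x)).2 (unidx (p x)).2));
  last first.
  by move=> x _; rewrite !mxE eqxx mul1r.
rewrite -(reindex_inj (@perm_inj _ p) (P := xpredT) (F := fun x => L (unidx x).1
  (unidx x).2 (unidx x).2))/=.
rewrite (reindex _ (curry_mxvec_bij N N)).
transitivity (\prod_k \prod_i L k i i).
  by rewrite pair_bigA; apply: eq_big => [[]|[k i] _] //=; rewrite unidxK.
by apply: eq_bigr => k _; rewrite det_trig.
Qed.

Lemma cV_integral_gauss_abs_det (L : 'I_N -> 'M[R]_N) f :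
  cV_integral (fun w => (abs_det L f w * gauss_prod w)%:E) = (gauss_abs_det L f)%:E.
Proof.
rewrite fineK//.
have C0 : 0 <= \prod_k mx_norm1 (L (f k)).
  by apply: prodr_ge0 => k _; exact: mx_norm1_ge0.
have [] := @cV_dominated_cvg R (N * N) (fun _ => abs_det L f)
  (abs_det L f) _ (fun _ => cV_measurable_abs_det L f) (cV_measurable_abs_det L f)
  (fun _ w => abs_det_ge0 _ _ _) (fun w => cvg_cst _) (fun _ => abs_det_le L f) C0.
by [].
Qed.

Definition mx_of_cV (x : 'cV[R]_(N * N)) : 'M[R]_N :=
  \matrix_(i, j) x (mxvec_index i j) 0.

Lemma quad_form_invmx (L : 'M[R]_N) x : L \in unitmx ->
  quad_form (invmx (L *m L^T)) x = dotv (invmx L *m x) (invmx L *m x).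
Proof.
move=> Lu; have -> : invmx (L *m L^T) = (invmx L)^T *m invmx L.
  have LLu : L *m L^T \in unitmx by rewrite unitmx_mul Lu unitmx_tr Lu.
  apply: (can_inj (mulKmx LLu)); rewrite mulmxV// -mulmxA (mulmxA L^T).
  by rewrite -trmx_mul mulVmx// trmx1 mul1mx mulmxV.
by rewrite /quad_form dotvE trmx_mul !mulmxA.
Qed.

Lemma integral_abs_det_rows (L : 'I_N -> 'M[R]_N) :
  (forall k, is_trig_mx (L k)) -> (forall k i, 0 < L k i i) ->
  cV_integral (fun x => (`|\det (mx_of_cV x)| *
    \prod_k expR (- 2^-1 * quad_form (invmx (L k *m (L k)^T)) (row k (mx_of_cV
      x))^T))%:E) =
  ((\prod_k \det (L k)) * gauss_abs_det L [ffun k => k])%:E.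
Proof.
move=> Ltrig Ldiag; set F := fun x => _.
have dL k : 0 < \det (L k) by rewrite det_trig// prodr_gt0.
have Lu k : L k \in unitmx by rewrite unitmxE unitfE gt_eqF.
have dR : 0 < \prod_k \det (L k) by rewrite prodr_gt0.
have Ru : rows_mx L \in unitmx by rewrite unitmxE unitfE det_rows_mx// gt_eqF.
have rowE w k : (row k (mx_of_cV (rows_mx L *m w)))^T =
    L k *m (\col_j w (mxvec_index k j) 0).
  apply/colP => i; rewrite 3![in LHS]mxE rows_mxE mxE; apply: eq_bigr => j _.
  by rewrite mxE.
have quadE k x : quad_form (invmx (L k *m (L k)^T)) (L k *m x) = dotv x x.
  by rewrite quad_form_invmx// mulKmx.
have FE w : F (rows_mx L *m w) = (abs_det L [ffun k => k] w * gauss_prod w)%:E.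
  rewrite /F; congr (_ * _)%:E.
    congr (`|\det _|); apply/matrixP => k i; rewrite [LHS]mxE rows_mxE mxE.
    by apply: eq_bigr => j _; rewrite ffunE.
  rewrite /gauss_prod (reindex _ (curry_mxvec_bij N N)).
  transitivity (\prod_k \prod_j gauss (w (mxvec_index k j) 0)).
    apply: eq_bigr => k _; rewrite rowE quadE -gauss_prodE.
    by apply: eq_bigr => j _; rewrite mxE.
  by rewrite pair_bigA; apply: eq_big => [[]|[]].
(* Measurability is carried over from the substituted integrand through the inverse substitution. *)
have mF : cV_measurable_fun F.
  have mG : cV_measurable_fun (fun w : 'cV[R]_(N * N) =>
      (abs_det L [ffun k => k] w * gauss_prod w)%:E).
    apply/measurable_EFinP.
    exact: (measurable_funM (cV_measurable_abs_det L [ffun k => k])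
      (@cV_measurable_gauss_prod R _)).
  have := cV_measurable_fun_mulmx (invmx (rows_mx L)) mG.
  congr (cV_measurable_fun _); apply/funext => x.
  by rewrite -FE mulKVmx.
rewrite -(scales_integral_unitmx Ru mF) => [|x]; last first.
  by rewrite lee_fin mulr_ge0// prodr_ge0// => k _; exact: expR_ge0.
rewrite det_rows_mx// gtr0_norm// EFinM -cV_integral_gauss_abs_det.
by congr (_ * _)%E; apply: cV_integral_ext => w; rewrite FE.
Qed.

Lemma ellipsoid_mulmx_trmx (L : 'M[R]_N) : L \in unitmx ->
  ellipsoid (L *m L^T) = [set L *m x | x in @unit_ball R N].
Proof.
move=> Lu; apply/seteqP; split=> [x|_ [y y1 <-]]; rewrite /ellipsoid/= quad_form_invmx//.
  by move=> x1; exists (invmx L *m x) => //; rewrite mulKVmx.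
by rewrite mulKmx.
Qed.

End row_substitution.

(** * The mixed volume of ellipsoids *)

Theorem corollary1p3 (R : realType) (d : nat) (hd : (1 <= d)%N)
    (Sigma : 'I_d -> 'M[R]_d) (hSigma : forall i, posdefmx (Sigma i)) :
  (mixed_volume (fun i => ellipsoid (Sigma i)))%:E =
  (((2 * pi) `^ (d%:R * (1 - d%:R) / 2) / d`!%:R
    * \prod_(i < d) (\det (Sigma i)) `^ (- 2^-1))%:E
   * \int[lebesgue_tuple R (d * d)]_t
       (`|\det (mx_of_tuple t)|
        * \prod_(i < d)
            expR (- 2^-1 * quad_form (invmx (Sigma i)) (row i (mx_of_tuple t))^T))%:E)%E.
Proof.
case: d hd Sigma hSigma => // n _ Sigma hSigma.
have /choice[L LE] := fun i => cholesky (hSigma i).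
have Ltrig k : is_trig_mx (L k) by have [] := LE k.
have Ldiag k i : 0 < L k i i by have [_ + _] := LE k; exact.
have LL k : Sigma k = L k *m (L k)^T by have [] := LE k.
have dL k : 0 < \det (L k) by rewrite det_trig// prodr_gt0.
have Lu k : L k \in unitmx by rewrite unitmxE unitfE gt_eqF.
have -> : (fun i => ellipsoid (Sigma i)) = (fun i => [set L i *m x | x in @unit_ball
  R n.+1]).
  by apply/funext => i; rewrite LL ellipsoid_mulmx_trmx.
rewrite (@mixed_volumeE _ _ _ (fun f => @mixed_const R n * gauss_abs_det L f));
  last first.
  split=> [p f|lam lam0]; first by rewrite gauss_abs_det_perm.
  exact: volume_mink_ball.
have -> : (\int[lebesgue_tuple R (n.+1 * n.+1)]_t
       (`|\det (mx_of_tuple t)| * \prod_(i < n.+1)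
            expR (- 2^-1 * quad_form (invmx (Sigma i)) (row i (mx_of_tuple t))^T))%:E)%E =
    ((\prod_k \det (L k)) * gauss_abs_det L [ffun k => k])%:E.
  rewrite -(integral_abs_det_rows Ltrig Ldiag); apply: eq_integral => t _.
  have -> : mx_of_cV (cV_of_tuple t) = mx_of_tuple t.
    by apply/matrixP => i j; rewrite !mxE.
  by congr (_ * _)%:E; apply: eq_bigr => i _; rewrite LL.
(* This factor cancels the Jacobian of the row substitution, since det Sigma_k is the square of det
   L_k > 0. *)
have prod_det : \prod_i (\det (Sigma i)) `^ (- 2^-1) = (\prod_k \det (L k))^-1.
  rewrite -prodfV; apply: eq_bigr => k _.
  rewrite LL det_mulmx det_tr powRN powR12_sqrt; last by rewrite mulr_ge0// ltW.
  by rewrite -expr2 sqrtr_sqr gtr0_norm.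
have dR : \prod_k \det (L k) != 0 by rewrite gt_eqF// prodr_gt0.
(* With d = n+1 the exponent is -n(n+1)/2; the 2^d of the zonotope formula cancels the 2^-d in
   [ball_const ^+ d]. *)
have constE : (2 * pi) `^ (n.+1%:R * (1 - n.+1%:R) / 2) / n.+1`!%:R = @mixed_const R n.
  have pi2 : 0 <= 2 * pi :> R by rewrite mulr_ge0 ?pi_ge0.
  have -> : n.+1%:R * (1 - n.+1%:R) / 2 = 2^-1 * - (n * n.+1)%:R :> R.
    by rewrite natrM -natr1; ring.
  rewrite powRrM powR12_sqrt// powR_invn ?sqrtr_ge0//.
  rewrite /mixed_const /ball_const exprVn exprMn invfM -exprM.
  have two0 : 2 ^+ n.+1 != 0 :> R by rewrite expf_neq0.
  by rewrite [RHS]mulrAC [in RHS]mulrA divff// mul1r.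
rewrite constE prod_det -EFinM; congr EFin.
by rewrite -[RHS]mulrA [X in _ = _ * X]mulrA mulVf// mul1r.
Qed.
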